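(* Let $T>0$, $d,m,p\in\mathbb N$, $x_0\in\mathbb R^d$, and let $f_0:\mathbb R^d\to\mathbb R^d$, $f:\mathbb R^d\to\mathbb R^{d\times m}$ and $c:\mathbb R^d\to\mathbb R^p$ be locally Lipschitz continuous. Suppose that there is a constant $\mathcal C$ such that $$2\langle x,f_0(x)\rangle+\|f(x)\|_F^2\le \mathcal C(1+\|x\|^2)\quad\text{for all }x\in\mathbb R^d.$$ For $u\in L^2([0,T];\mathbb R^m)$ let $x(\cdot;u)$ be the solution on $[0,T]$ of $$\dot x(t)=f_0(x(t))+f(x(t))u(t),\quad x(0)=x_0,$$ and let $y(t;u)=c(x(t;u))$. Let $\mathcal K\subset L^2([0,T];\mathbb R^m)$ be compact. Then, for every $\varepsilon>0$ there exist an $N\in\mathbb N$ and a matrix $C\in\mathbb R^{p\times n}$ with $n=\sum_{k=0}^N (m+1)^k$, such that $$\sup_{t\in[0,T]}\ \sup_{u\in\mathcal K}\ \|y(t;u)-C\,S^N_{0,t}(\hat U)\|<\varepsilon ,$$ where, for each $u\in\mathcal K$, $\hat U(t)=(t,U(t)^\top)^\top\in\mathbb R^{m+1}$ with $U(t)=\int_0^t u(s)\,\mathrm ds$, $t\in[0,T]$, and $S^N_{0,t}(\hat U)$ is the truncated signature of order $N$ of $\hat U$ over $[0,t]$.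
   Context: $\|\cdot\|$ is the Euclidean norm, $\|\cdot\|_F$ the Frobenius norm. A map $g$ on $\mathbb R^d$ is locally Lipschitz if for every $R>0$ there is $L_{g,R}>0$ with $\|g(x)-g(z)\|\le L_{g,R}\|x-z\|$ for all $\|x\|,\|z\|\le R$. Solutions of the controlled equation are absolutely continuous functions satisfying the associated integral equation. Under the stated assumptions on $f_0,f$, for every $u\in L^2([0,T];\mathbb R^m)$ there is a unique global solution on $[0,T]$. Truncated signature: for a continuous path of bounded variation $X:[0,T]\to\mathbb R^{M}$ and $0\le a<b\le T$, the iterated (Riemann–Stieltjes) integrals are $X^{(k)}_{a,b}=\int\cdots\int_{a<s_1<\cdots<s_k<b}\mathrm dX(s_1)\otimes\cdots\otimes \mathrm dX(s_k)\in\mathbb R^{M^k}$, where $\otimes$ is the Kronecker product, and $S^N_{a,b}(X)=(1,{X^{(1)}_{a,b}}^\top,\dots,{X^{(N)}_{a,b}}^\top)^\top\in\mathbb R^{\sum_{k=0}^N M^k}$. For $a=b$, the iterated integrals vanish, so $S^N_{a,a}(X)=(1,0,\dots,0)^\top$. Here $M=m+1$. *)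

(* Defs.v *)
From HB Require Import structures.
From mathcomp Require Import all_boot all_order all_algebra.
From mathcomp Require Import all_classical all_reals all_analysis.
From mathcomp Require Import measurable_realfun.
From mathcomp Require Import ring.

Set Implicit Arguments.
Unset Strict Implicit.
Unset Printing Implicit Defensive.
Import Order.TTheory GRing.Theory Num.Theory.
Import numFieldNormedType.Exports.
Local Open Scope classical_set_scope.
Local Open Scope ring_scope.

(* The norm `|A| that the library puts on matrices is the max norm, hence this
   definition. On columns the Frobenius norm is the Euclidean norm. *)
Definition frob {R : realType} {q r : nat} (A : 'M[R]_(q, r)) : R :=
  Num.sqrt (\sum_i \sum_j A i j ^+ 2).

Definition inner {R : realType} {q : nat} (v w : 'cV[R]_q) : R :=
  \sum_i v i 0 * w i 0.

Definition locally_lipschitz {R : realType} {d q r : nat}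
    (g : 'cV[R]_d -> 'M[R]_(q, r)) : Prop :=
  forall rho : R, 0 < rho -> exists2 L : R, 0 < L &
    forall x z : 'cV[R]_d, frob x <= rho -> frob z <= rho ->
      frob (g x - g z) <= L * frob (x - z).

(* Square-integrable functions [0, T] -> R^m. The elements are representatives
   rather than classes modulo a.e. equality (values outside [0, T] are
   irrelevant), so the L^2-distance below is only a pseudometric; a set of
   representatives is compact for it iff the set of their classes is compact
   in L^2([0, T]; R^m). *)
Record L2 (R : realType) (m : nat) (T : R) := MkL2 {
  L2_fun :> R -> 'cV[R]_m ;
  L2_measurable : forall i, measurable_fun `[0, T] (fun t => L2_fun t i 0) ;
  L2_integrable : (@lebesgue_measure R).-integrable `[0, T]
    (fun t => (frob (L2_fun t) ^+ 2)%:E)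
}.

Definition L2_dist {R : realType} {m : nat} {T : R} (u v : L2 m T) : R :=
  Num.sqrt (\int[lebesgue_measure]_(t in `[0, T]) (frob (u t - v t) ^+ 2)).

Definition L2_ball {R : realType} {m : nat} {T : R} (u : L2 m T) (e : R) :
  set (L2 m T) := [set v | L2_dist u v < e].

Section L2_pseudometric.
Context {R : realType} {m : nat} {T : R}.
Implicit Types u v w : L2 m T.

Let frob_sqr (q r : nat) (A : 'M[R]_(q, r)) :
  frob A ^+ 2 = \sum_i \sum_j A i j ^+ 2.
Proof.
by rewrite sqr_sqrtr// sumr_ge0// => i _; rewrite sumr_ge0// => j _; rewrite sqr_ge0.
Qed.

Let frob_sqr_le (q r : nat) (A B : 'M[R]_(q, r)) (a b : R) : 0 < a -> 0 < b ->
  frob (A + B) ^+ 2 <= (1 + b / a) * frob A ^+ 2 + (1 + a / b) * frob B ^+ 2.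
Proof.
move=> a0 b0; rewrite !frob_sqr !mulr_sumr -big_split/= ler_sum// => i _.
rewrite !mulr_sumr -big_split/= ler_sum// => j _; rewrite !mxE.
set x := A i j; set y := B i j; rewrite -subr_ge0.
have -> : (1 + b / a) * x ^+ 2 + (1 + a / b) * y ^+ 2 - (x + y) ^+ 2 =
    (b * x - a * y) ^+ 2 / (a * b).
  by field; rewrite !gt_eqF.
by rewrite divr_ge0 ?sqr_ge0// mulr_ge0// ltW.
Qed.

Let integrable_sub u v : (@lebesgue_measure R).-integrable `[0, T]
  (fun t => (frob (u t - v t) ^+ 2)%:E).
Proof.
have iZ w : (@lebesgue_measure R).-integrable `[0, T]
    (fun t => 2%:E * (frob (w t) ^+ 2)%:E)%E.
  by apply: integrableZl => //; exact: L2_integrable.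
have := integrableD _ (iZ u) (iZ v) => /(_ (measurable_itv _)).
apply: le_integrable => //.
  apply/measurable_EFinP.
  apply: (eq_measurable_fun
      (fun t : R => \sum_i \sum_j (u t i 0 - v t i 0) ^+ 2)) => [t _|].
    rewrite frob_sqr; apply: eq_bigr => i _; apply: eq_bigr => j _.
    by rewrite ord1 !mxE.
  apply: measurable_sum => i; apply: measurable_sum => j.
  by apply/measurable_funX/measurable_funB; exact: L2_measurable.
move=> t _ /=; rewrite lee_fin ger0_norm ?sqr_ge0//.
rewrite (le_trans _ (ler_norm _))//.
have := frob_sqr_le (u t) (- v t) ltr01 ltr01.
have -> : frob (- v t) = frob (v t).
  by congr Num.sqrt; apply: eq_bigr => i _; apply: eq_bigr => j _; rewrite mxE sqrrN.
by rewrite divr1.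
Qed.

Lemma L2_ball_center u (e : R) : 0 < e -> L2_ball u e u.
Proof.
move=> e0; rewrite /L2_ball/= /L2_dist (_ : \int[_]_(_ in _) _ = 0) ?sqrtr0//.
under eq_Rintegral => t _.
  rewrite subrr frob_sqr big1; first over.
  by move=> i _; rewrite big1// => j _; rewrite mxE expr0n.
by rewrite Rintegral_cst//= mul0r.
Qed.

Lemma L2_dist_sym u v : L2_dist u v = L2_dist v u.
Proof.
congr Num.sqrt; apply: eq_Rintegral => t _; rewrite !frob_sqr.
by apply: eq_bigr => i _; apply: eq_bigr => j _; rewrite !mxE -sqrrN opprB.
Qed.

Lemma L2_ball_sym u v (e : R) : L2_ball u e v -> L2_ball v e u.
Proof. by rewrite /L2_ball/= L2_dist_sym. Qed.

Let int_ge0 u v :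
  0 <= \int[lebesgue_measure]_(t in `[0, T]) (frob (u t - v t) ^+ 2).
Proof. by apply: Rintegral_ge0 => t _; rewrite sqr_ge0. Qed.

Let ball_gt0 u v (e : R) : L2_ball u e v -> 0 < e.
Proof. exact/le_lt_trans/sqrtr_ge0. Qed.

Let ballE u v (e : R) : 0 < e ->
  (L2_dist u v < e) =
  (\int[lebesgue_measure]_(t in `[0, T]) (frob (u t - v t) ^+ 2) < e ^+ 2).
Proof.
by move=> e0; rewrite -[RHS]ltr_sqrt ?exprn_gt0// sqrtr_sqr gtr0_norm.
Qed.

Lemma L2_ball_triangle u v w (a b : R) :
  L2_ball u a v -> L2_ball v b w -> L2_ball u (a + b) w.
Proof.
move=> uv vw; have a0 := ball_gt0 uv; have b0 := ball_gt0 vw.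
move: uv vw; rewrite /L2_ball/= !ballE ?addr_gt0// => uv vw.
have iZ c u1 u2 : (@lebesgue_measure R).-integrable `[0, T]
    (EFin \o (fun t => c * frob (u1 t - u2 t) ^+ 2)).
  rewrite (_ : _ \o _ = fun t => c%:E * (frob (u1 t - u2 t) ^+ 2)%:E)%E//.
  by apply: integrableZl => //; exact: integrable_sub.
have le : \int[lebesgue_measure]_(t in `[0, T]) (frob (u t - w t) ^+ 2) <=
    (1 + b / a) * (\int[lebesgue_measure]_(t in `[0, T]) (frob (u t - v t) ^+ 2)) +
    (1 + a / b) * (\int[lebesgue_measure]_(t in `[0, T]) (frob (v t - w t) ^+ 2)).
  rewrite -!RintegralZl//; [|exact: integrable_sub..].
  rewrite -RintegralD//.
  apply: le_Rintegral => //; first exact: integrable_sub.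
    have := integrableD _ (iZ (1 + b / a) u v) (iZ (1 + a / b) v w).
    exact.
  move=> t _; have := frob_sqr_le (u t - v t) (v t - w t) a0 b0.
  by rewrite addrA subrK.
apply: (le_lt_trans le).
have -> : (a + b) ^+ 2 = (1 + b / a) * a ^+ 2 + (1 + a / b) * b ^+ 2.
  by field; rewrite !gt_eqF.
by rewrite ltrD// ltr_pM2l// addr_gt0// divr_gt0.
Qed.

HB.instance Definition _ := gen_eqMixin (L2 m T).
HB.instance Definition _ := gen_choiceMixin (L2 m T).
HB.instance Definition _ := hasNbhs.Build (L2 m T) (nbhs_ball_ (@L2_ball R m T)).

Let nbhs_L2E : @nbhs _ (L2 m T) = nbhs_ (entourage_ (@L2_ball R m T)).
Proof.
rewrite predeq2E => u A; split.
  move=> [e e0 uA]; exists [set vw | L2_ball vw.1 e vw.2]; first by exists e.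
  by move=> v /xsectionP; exact: uA.
move=> [E [e e0 eE] EA]; exists e => // v uv.
by apply/EA/xsectionP/eE.
Qed.

HB.instance Definition _ := Nbhs_isPseudoMetric.Build R (L2 m T)
  nbhs_L2E L2_ball_center L2_ball_sym L2_ball_triangle erefl.

End L2_pseudometric.

Definition absolutely_continuous_on {R : realType} {d : nat} (a b : R)
    (x : R -> 'cV[R]_d) : Prop :=
  forall eps : R, 0 < eps -> exists2 delta : R, 0 < delta &
    forall (n : nat) (l r : 'I_n -> R),
      (forall k, [/\ a <= l k, l k <= r k & r k <= b]) ->
      (forall j k, j != k -> r j <= l k \/ r k <= l j) ->
      \sum_k (r k - l k) < delta ->
      \sum_k frob (x (r k) - x (l k)) < eps.

Definition vint {R : realType} {q : nat} (a b : R) (g : R -> 'cV[R]_q) :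
  'cV[R]_q := \col_i \int[lebesgue_measure]_(s in `[a, b]) g s i 0.

Definition is_solution {R : realType} {d m : nat} (T : R) (x0 : 'cV[R]_d)
    (f0 : 'cV[R]_d -> 'cV[R]_d) (f : 'cV[R]_d -> 'M[R]_(d, m))
    (u : R -> 'cV[R]_m) (x : R -> 'cV[R]_d) : Prop :=
  absolutely_continuous_on 0 T x /\
  forall t, 0 <= t <= T -> x t = x0 + vint 0 t (fun s => f0 (x s) + f (x s) *m u s).

(* t_0 = a < t_1 < ... < t_n = b are the points of the partition a :: s of
   [a, b], and xi k is the tag in [t_k, t_(k+1)]. *)
Definition RS_sum {R : realType} (F G : R -> R) (a b : R) (s : seq R)
    (xi : nat -> R) : R :=
  let t := nth b (a :: s) in
  \sum_(0 <= k < size s) F (xi k) * (G (t k.+1) - G (t k)).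

Definition is_RS_integral {R : realType} (F G : R -> R) (a b I : R) : Prop :=
  forall eps : R, 0 < eps -> exists2 delta : R, 0 < delta &
    forall (s : seq R) (xi : nat -> R), itv_partition a b s ->
      let t := nth b (a :: s) in
      (forall k, (k < size s)%N ->
        t k.+1 - t k < delta /\ t k <= xi k <= t k.+1) ->
      `|RS_sum F G a b s xi - I| < eps.

(* Riemann-Stieltjes integral of F with respect to G over [a, b]; 0 if it does
   not exist. *)
Definition RS_integral {R : realType} (F G : R -> R) (a b : R) : R :=
  xget 0 (is_RS_integral F G a b).

(* The vector integral of F(s) (x) dX(s), where (x) is the Kronecker product:
   mxvec is row-major, so that (i, j) has index i * M + j. *)
Definition kron_integral {R : realType} {q M : nat} (F : R -> 'cV[R]_q)
    (X : R -> 'cV[R]_M) (a b : R) : 'cV[R]_(q * M) :=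
  (mxvec (\matrix_(i < q, j < M)
     RS_integral (fun s => F s i 0) (fun s => X s j 0) a b))^T.

(* X^(k)_(a,b), integrating over the largest variable s_k last. *)
Fixpoint iterated_integral {R : realType} {M : nat} (X : R -> 'cV[R]_M)
    (k : nat) (a b : R) : 'cV[R]_(M ^ k) :=
  match k return 'cV[R]_(M ^ k) with
  | 0%N => const_mx 1
  | k'.+1 => castmx (esym (expnSr M k'), erefl 1%N)
               (kron_integral (fun s => iterated_integral X k' a s) X a b)
  end.

Definition signature {R : realType} {M : nat} (X : R -> 'cV[R]_M) (N : nat)
    (a b : R) : 'cV[R]_(\sum_(k < N.+1) M ^ k) :=
  \mxcol_(k < N.+1) iterated_integral X k a b.

Definition augmented_path {R : realType} {m : nat} (u : R -> 'cV[R]_m) (t : R) :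
  'cV[R]_m.+1 := col_mx (t%:M : 'M[R]_1) (vint 0 t u).

(* Main.v *)
Require Import Defs.
From HB Require Import structures.
From mathcomp Require Import all_boot all_order all_algebra.
From mathcomp Require Import all_classical all_reals all_analysis.
From mathcomp Require Import measurable_realfun.
From mathcomp Require Import ring lra zify.

Set Implicit Arguments.
Unset Strict Implicit.
Unset Printing Implicit Defensive.
Import Order.TTheory GRing.Theory Num.Theory.
Import numFieldNormedType.Exports.
Local Open Scope classical_set_scope.
Local Open Scope ring_scope.

(** The signature functionals, that is, the linear combinations of iterated
    integrals of the driving path t |-> (t, U(t)), form an algebra (shuffle
    product) which is stable under integration against each component of the
    driving path. Let sigapprox K be the class of their uniform limits on
    K x [0, T]. The theorem holds because every Picard iterate of a slightly
    modified equation belongs to this class, and these iterates approximate the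
    solution uniformly. Compactness of K enters through its boundedness in L^2
    ([L2_compact_bounded]).

    - The growth condition and Gronwall's inequality, applied to 1 + |x|^2 and
      to the kernel C + |u|^2, confine all the solutions with control in K to
      one box ([solution_bounded]). On this box the vector fields and the
      output map are Lipschitz.

    - On a bounded interval the absolute value is a uniform limit of
      polynomials; hence sigapprox K is stable under absolute values and minima
      ([sigapprox_norm], [sigapprox_min]).

    - By McShane's extension formula, an L-Lipschitz function g is, up to any
      prescribed error on the box, the minimum over finitely many points z of
      the cones g(z) + L |x - z|_1 ([mcshane_approx]). This minimum is globally
      L-Lipschitz, and substituting members of sigapprox K into it gives a
      member of sigapprox K ([sigapprox_mcshane]).

    - Consequently the Picard iterates of the equation whose vector fields are
      replaced by such minima all lie in sigapprox K ([sigapprox_picard]). The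
      Lipschitz constant does not depend on the accuracy of the minima, so the
      iterates come arbitrarily close to the solution, uniformly on K x [0, T],
      by an iterated Gronwall inequality ([iterated_gronwall], [solution_approx]). Applying
      the same substitution to the output map finishes the proof
      ([output_approx]).

    The calculus needed is that of primitives G(t) = G(0) + int_0^t g of
    integrable functions: the Riemann-Stieltjes integral of a continuous F
    against G is the Lebesgue integral of F g ([is_RS_integral_prim]), and the
    product rule ([prim_prod]) is summation by parts in Riemann-Stieltjes sums.
    The product rule yields the shuffle identity ([shuffle_words]). *)

(** * Primitives on [0, T] *)

Section interval_calculus.
Context {R : realType}.
Notation mu := (@lebesgue_measure R).
Implicit Types (f g F G : R -> R) (t s : R).

(** The primitive of [g] that vanishes at 0. *)
Definition prim g t : R := \int[mu]_(s in `[0, t]) g s.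

(** Lebesgue integrability on [0, T]. *)
Definition intble (T : R) g := mu.-integrable `[0, T] (EFin \o g).

(** Uniform continuity on [0, T]; the values outside [0, T] are irrelevant. *)
Definition ucont (T : R) F := forall e : R, 0 < e -> exists2 dl : R, 0 < dl &
  forall s t, 0 <= s <= T -> 0 <= t <= T -> `|s - t| < dl -> `|F s - F t| < e.

Variable T : R.
Hypothesis T_ge0 : 0 <= T.

Lemma ucont_cst c : ucont T (fun=> c).
Proof. by move=> e e0; exists 1 => // s t _ _ _; rewrite subrr normr0. Qed.

Lemma ucontZ c F : ucont T F -> ucont T (fun t => c * F t).
Proof.
move=> cF e e0; have c0 : 0 < `|c| + 1 by rewrite ltr_wpDl.
have [dl dl0 H] := cF (e / (`|c| + 1)) (divr_gt0 e0 c0); exists dl => // s t hs ht st.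
rewrite -mulrBr normrM.
have := H s t hs ht st; rewrite ltr_pdivlMr// mulrC => h.
by apply: le_lt_trans h; rewrite ler_wpM2r// lerDl.
Qed.

Lemma ucontD F G : ucont T F -> ucont T G -> ucont T (fun t => F t + G t).
Proof.
move=> cF cG e e0; have e2 : 0 < e / 2 by rewrite divr_gt0.
have [d1 d10 H1] := cF _ e2; have [d2 d20 H2] := cG _ e2.
exists (Num.min d1 d2); first by rewrite lt_min d10.
move=> s t hs ht; rewrite lt_min => /andP[/(H1 _ _ hs ht) h1 /(H2 _ _ hs ht) h2].
rewrite opprD addrACA [e]splitr; exact: (le_lt_trans (ler_normD _ _) (ltrD h1 h2)).
Qed.

Lemma ucont_sum I (r : seq I) (F : I -> R -> R) :
  (forall i, ucont T (F i)) -> ucont T (fun t => \sum_(i <- r) F i t).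
Proof.
move=> cF; elim: r => [|i r ih].
  by under eq_fun do rewrite big_nil; exact: ucont_cst.
by under eq_fun do rewrite big_cons; exact: ucontD.
Qed.

Lemma ucont_le F G : ucont T G ->
  (forall s t, 0 <= s <= T -> 0 <= t <= T -> `|F s - F t| <= `|G s - G t|) ->
  ucont T F.
Proof.
move=> cG FG e e0; have [dl dl0 H] := cG e e0; exists dl => // s t hs ht st.
by apply: le_lt_trans (H _ _ hs ht st); exact: FG.
Qed.

Lemma ucont_eq F G : ucont T F -> (forall t, 0 <= t <= T -> F t = G t) -> ucont T G.
Proof. by move=> cF FG; apply: (ucont_le cF) => s t hs ht; rewrite !FG. Qed.

Lemma ucont_norm F : ucont T F -> ucont T (fun t => `|F t|).
Proof. by move=> /ucont_le; apply=> s t _ _; exact: ler_dist_dist. Qed.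

Lemma ucont_within F : ucont T F -> {within `[0, T], continuous F}.
Proof.
move=> cF; apply/subspace_continuousP => t; rewrite /= in_itv/= => ht.
apply/cvgrPdist_lt => e e0; have [dl dl0 H] := cF e e0.
rewrite near_withinE/=.
near=> s; rewrite in_itv/= => hs; apply: (H _ _ ht hs).
near: s; exists dl => // s /=.
Unshelve. all: by end_near. Qed.

Lemma ucont_bounded F : ucont T F ->
  exists2 M, 0 <= M & forall t, 0 <= t <= T -> `|F t| <= M.
Proof.
move=> /ucont_norm/ucont_within/(EVT_max T_ge0)[c _ H]; by exists `|F c|.
Qed.

Lemma ucont_measurable F : ucont T F -> measurable_fun `[0, T] F.
Proof. by move=> /ucont_within; exact: subspace_continuous_measurable_fun. Qed.

Lemma ucontM F G : ucont T F -> ucont T G -> ucont T (fun t => F t * G t).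
Proof.
move=> cF cG e e0.
have [A A0 HA] := ucont_bounded cF; have [B B0 HB] := ucont_bounded cG.
have c0 : 0 < A + B + 1 by rewrite ltr_wpDl// addr_ge0.
have [d1 d10 H1] := cF _ (divr_gt0 e0 c0); have [d2 d20 H2] := cG _ (divr_gt0 e0 c0).
exists (Num.min d1 d2); first by rewrite lt_min d10.
move=> s t hs ht; rewrite lt_min => /andP[/(H1 _ _ hs ht) h1 /(H2 _ _ hs ht) h2].
have -> : F s * G s - F t * G t = F s * (G s - G t) + (F s - F t) * G t by ring.
have -> : e = (A + B + 1) * (e / (A + B + 1)) by field; rewrite gt_eqF.
set h := e / _ in h1 h2 *; have h0 : 0 < h by rewrite divr_gt0.
apply: (@le_lt_trans _ _ (A * h + h * B)); last first.
  by rewrite [h * B]mulrC -mulrDl ltr_pM2r// ltrDl.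
rewrite (le_trans (ler_normD _ _))// !normrM lerD//.
  by rewrite ler_pM// ?HA// ltW.
by rewrite ler_pM// ?HB// ltW.
Qed.

Lemma intble_cst c : intble T (fun=> c).
Proof.
apply: measurable_bounded_integrable => //.
  by rewrite /= lebesgue_measure_itv; case: ifPn => //= _; rewrite ltry.
by exists `|c|; split; [exact: num_real|move=> x /ltW cx y _ /=].
Qed.

Lemma intbleD f g : intble T f -> intble T g -> intble T (fun t => f t + g t).
Proof. by move=> If Ig; apply: (integrableD _ If Ig). Qed.

Lemma intbleZ c f : intble T f -> intble T (fun t => c * f t).
Proof.
move=> If; rewrite /intble (_ : _ \o _ = fun t => (c%:E * (f t)%:E)%E)//.
exact: integrableZl.
Qed.

Lemma intble_sum I (r : seq I) (f : I -> R -> R) :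
  (forall i, intble T (f i)) -> intble T (fun t => \sum_(i <- r) f i t).
Proof.
move=> cF; elim: r => [|i r ih].
  by under eq_fun do rewrite big_nil; exact: intble_cst.
by under eq_fun do rewrite big_cons; exact: intbleD.
Qed.

Lemma intble_norm f : intble T f -> intble T (fun t => `|f t|).
Proof. exact: integrable_norm. Qed.

Lemma intble_eq f g : intble T f -> (forall t, 0 <= t <= T -> f t = g t) -> intble T g.
Proof.
move=> + fg; apply: eq_integrable => // t; rewrite inE/= in_itv/= => ht.
by rewrite /= fg.
Qed.

Lemma intble_le f g : measurable_fun `[0, T] f -> intble T g ->
  (forall t, 0 <= t <= T -> `|f t| <= g t) -> intble T f.
Proof.
move=> mf Ig fg; apply: (le_integrable _ _ _ Ig) => //.
  exact/measurable_EFinP.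
move=> t /=; rewrite in_itv/= => /fg h; rewrite lee_fin.
exact: (le_trans h (ler_norm _)).
Qed.

Lemma intbleM F f : ucont T F -> intble T f -> intble T (fun t => F t * f t).
Proof.
move=> cF If.
rewrite /intble (_ : _ \o _ = ((EFin \o F) \* (EFin \o f))%E)//.
apply: integrableMr => //; first exact: ucont_measurable.
have [M M0 H] := ucont_bounded cF.
exists M; split; first exact: num_real.
by move=> x /ltW Mx y /=; rewrite in_itv/= => /H /le_trans; apply.
Qed.

Lemma intble_itv f s t : intble T f -> 0 <= s -> t <= T ->
  mu.-integrable `[s, t] (EFin \o f).
Proof.
move=> If s0 tT; apply: integrableS If => //; apply: subset_itv; by rewrite bnd_simp.
Qed.

Lemma prim0 f : prim f 0 = 0.
Proof. by rewrite /prim set_itv1 Rintegral_set1. Qed.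

Lemma eq_prim f g t : t <= T -> (forall s, 0 <= s <= T -> f s = g s) ->
  prim f t = prim g t.
Proof.
move=> tT fg; apply: eq_Rintegral => s; rewrite inE/= in_itv/= => /andP[s0 st].
by apply: fg; rewrite s0 (le_trans st).
Qed.

Lemma primZ c f t : intble T f -> t <= T -> prim (fun s => c * f s) t = c * prim f t.
Proof. by move=> If tT; rewrite /prim RintegralZl//; exact: intble_itv. Qed.

Lemma primD f g t : intble T f -> intble T g -> t <= T ->
  prim (fun s => f s + g s) t = prim f t + prim g t.
Proof. by move=> If Ig tT; rewrite /prim RintegralD//; exact: intble_itv. Qed.

Lemma primB f g t : intble T f -> intble T g -> t <= T ->
  prim (fun s => f s - g s) t = prim f t - prim g t.
Proof. by move=> If Ig tT; rewrite /prim RintegralB//; exact: intble_itv. Qed.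

Lemma prim_cst0 t : prim (fun=> 0) t = 0.
Proof. by rewrite /prim Rintegral_cst//= mul0r. Qed.

Lemma prim_cst c t : 0 <= t -> prim (fun=> c) t = c * t.
Proof.
rewrite le_eqVlt => /predU1P[<-|t0]; first by rewrite prim0 mulr0.
by rewrite /prim Rintegral_cst//= lebesgue_measure_itv /= lte_fin t0 /= oppr0 addr0.
Qed.

Lemma prim_sum I (r : seq I) (f : I -> R -> R) t :
  (forall i, intble T (f i)) -> t <= T ->
  prim (fun s => \sum_(i <- r) f i s) t = \sum_(i <- r) prim (f i) t.
Proof.
move=> If tT; elim: r => [|i r ih].
  by under eq_fun do rewrite big_nil; rewrite big_nil prim_cst0.
under eq_fun do rewrite big_cons.
by rewrite big_cons primD ?ih//; exact: intble_sum.
Qed.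

Lemma prim_le f g t : intble T f -> intble T g -> t <= T ->
  (forall s, 0 <= s <= t -> f s <= g s) -> prim f t <= prim g t.
Proof.
move=> If Ig tT fg; apply: le_Rintegral => //; exact: intble_itv.
Qed.

Lemma prim_norm f t : intble T f -> t <= T -> `|prim f t| <= prim (fun s => `|f s|) t.
Proof. by move=> If tT; apply: le_normr_Rintegral => //; exact: intble_itv. Qed.

Lemma prim_ge0 f t : (forall s, 0 <= s <= t -> 0 <= f s) -> 0 <= prim f t.
Proof. by move=> H; apply: Rintegral_ge0 => s /=; rewrite in_itv/=; exact: H. Qed.

Lemma primBE f s t : intble T f -> 0 <= s <= t -> t <= T ->
  prim f t - prim f s = \int[mu]_(r in `[s, t]) f r.
Proof.
move=> If /andP[s0 st] tT; rewrite /prim Rintegral_itvB//.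
- rewrite Rintegral_itv_obnd_cbnd//.
  by apply: integrableS (intble_itv If s0 tT) => //; apply: subset_itv; rewrite bnd_simp.
- exact: intble_itv.
Qed.

Lemma prim_mono f s t : intble T f -> (forall r, 0 <= r <= T -> 0 <= f r) ->
  0 <= s <= t -> t <= T -> prim f s <= prim f t.
Proof.
move=> If f0 /andP[s0 st] tT; rewrite -subr_ge0 primBE ?s0//.
apply: Rintegral_ge0 => r /=; rewrite in_itv/= => /andP[sr rt].
by rewrite f0// (le_trans s0)//= (le_trans rt).
Qed.

(** The absolute continuity of the integral, applied to [f] extended by 0. *)
Lemma ucont_prim f : intble T f -> ucont T (prim f).
Proof.
move=> If e e0.
have Ir : mu.-integrable setT (EFin \o (f \_ `[0, T])).
  rewrite (_ : _ \o _ = (EFin \o f) \_ `[0, T]); last by rewrite restrict_EFin.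
  by move: If; rewrite /intble integrable_mkcond.
have [dl [dl0 H]] := integral_normr_continuous Ir e0; exists dl => //.
have main s t : 0 <= s <= t -> t <= T -> t - s < dl -> `|prim f t - prim f s| < e.
  move=> hst tT tsd; rewrite primBE//; have /andP[s0 st] := hst.
  apply: le_lt_trans (H `[s, t]%classic _ _) => //; last first.
    rewrite /= lebesgue_measure_itv /= lte_fin.
    by case: ifPn => _; rewrite ?lte_fin.
  rewrite (le_trans (le_normr_Rintegral _ _))//; first exact: intble_itv.
  rewrite le_eqVlt; apply/orP; left; apply/eqP/eq_Rintegral => r; rewrite inE/= in_itv/= => /andP[sr rt].
  by rewrite patchE mem_set//= in_itv/= (le_trans s0 sr) (le_trans rt tT).
move=> s t /andP[s0 sT] /andP[t0 tT] std.
have [st|/ltW ts] := leP s t.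
  rewrite distrC main ?s0//; apply: le_lt_trans std.
  by rewrite distrC ler_norm.
by rewrite main ?t0//; apply: le_lt_trans std; rewrite ler_norm.
Qed.

End interval_calculus.

(** * Riemann-Stieltjes integrals *)

Section Riemann_Stieltjes.
Context {R : realType}.
Notation mu := (@lebesgue_measure R).
Implicit Types (f g F G : R -> R) (a b t : R).

Lemma RS_sum_cons F G a b c s (xi : nat -> R) :
  RS_sum F G a b (c :: s) xi =
  F (xi 0%N) * (G c - G a) + RS_sum F G c b s (xi \o S).
Proof. by rewrite /RS_sum /= big_nat_recl. Qed.

(** There are arbitrarily fine partitions; without this, any number would be a
    Riemann-Stieltjes integral. *)
Lemma ex_itv_partition a b (dl : R) : a <= b -> 0 < dl ->
  exists2 s, itv_partition a b s & forall k, (k < size s)%N ->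
    nth b (a :: s) k.+1 - nth b (a :: s) k < dl.
Proof.
move=> + dl0; have [n] : exists n : nat, b - a < n%:R * (dl / 2).
  have h : 0 < dl / 2 by rewrite divr_gt0.
  exists (Num.truncn ((b - a) / (dl / 2))).+1; rewrite -ltr_pdivrMr//.
  exact: truncnS_gt.
(* Cut off pieces of length dl / 2, strictly shorter than the mesh. *)
elim: n a => [|n ih] a; first by rewrite mul0r subr_lt0 ltNge => /negP.
move=> abn; rewrite le_eqVlt => /predU1P[->|ab]; first by exists [::].
have [h|h] := ltP (b - a) dl.
  by exists [:: b]; [exact: itv_partition1|case].
have cb : a + dl / 2 < b by lra.
have [||s [s1 s2] s3] := ih (a + dl / 2); [|exact: ltW|].
  by move: abn; rewrite -natr1 mulrDl mul1r; lra.
exists (a + dl / 2 :: s).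
  by split => //=; rewrite s1 andbT; lra.
by case=> [_|k /s3 //] /=; lra.
Qed.

Lemma is_RS_integral_unique F G a b (I J : R) : a <= b ->
  is_RS_integral F G a b I -> is_RS_integral F G a b J -> I = J.
Proof.
move=> ab hI hJ; apply/eqP; rewrite -subr_eq0 -normr_le0 leNgt; apply/negP => e0.
have e2 : 0 < `|I - J| / 2 by rewrite divr_gt0.
have [d1 d10 H1] := hI _ e2; have [d2 d20 H2] := hJ _ e2.
have [|s ps hs] := @ex_itv_partition a b (Num.min d1 d2) ab; first by rewrite lt_min d10.
pose xi := nth b (a :: s).
have xis k : (k < size s)%N -> xi k <= xi k <= xi k.+1.
  move=> ks; rewrite lexx /=; case: ps => /(pathP b) /(_ k ks) /ltW + _; exact.
have /H1 := ps => /(_ xi) /= h1; have /H2 := ps => /(_ xi) /= h2.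
have : `|I - J| < `|I - J| / 2 + `|I - J| / 2.
  rewrite -[X in `|X| < _](subrKA (RS_sum F G a b s xi)).
  rewrite (le_lt_trans (ler_normD _ _))// ltrD//.
    rewrite distrC; apply: h1 => k ks; split; last exact: xis.
    by have := hs k ks; rewrite lt_min => /andP[].
  apply: h2 => k ks; split; last exact: xis.
  by have := hs k ks; rewrite lt_min => /andP[].
by rewrite -splitr ltxx.
Qed.

Lemma RS_integralE F G a b (I : R) : a <= b -> is_RS_integral F G a b I ->
  RS_integral F G a b = I.
Proof.
move=> ab hI; apply: (is_RS_integral_unique ab _ hI).
by rewrite /RS_integral; apply: xgetPex; exists I.
Qed.

Variable T : R.

(** The error of a Riemann-Stieltjes sum on a single interval, when [eta] bounds
    the oscillation of [F] around the tag [x]. *)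
Lemma RS_step F G g a b (x eta : R) : ucont T F -> intble T g ->
  (forall t, 0 <= t <= T -> G t = G 0 + prim g t) ->
  0 <= a <= b -> b <= T ->
  (forall r, a <= r <= b -> `|F x - F r| <= eta) ->
  `|F x * (G b - G a) -
     (prim (fun t => F t * g t) b - prim (fun t => F t * g t) a)| <=
  eta * (prim (fun t => `|g t|) b - prim (fun t => `|g t|) a).
Proof.
move=> cF Ig Gg /andP[a0 ab] bT H.
have T0 : 0 <= T by rewrite (le_trans a0)// (le_trans ab).
have IFg := intbleM T0 cF Ig.
have hab : 0 <= a <= b by rewrite a0.
rewrite (Gg b) ?bT ?(le_trans a0)// (Gg a) ?a0 ?(le_trans ab)//.
rewrite opprD addrACA subrr add0r !(@primBE _ T)//; last exact: intble_norm.
have Ig' := intble_itv Ig a0 bT; have IFg' := intble_itv IFg a0 bT.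
rewrite -RintegralZl// -RintegralB//; last first.
  exact: (intble_itv (intbleZ (F x) Ig) a0 bT).
have Id : intble T (fun t => F x * g t - F t * g t).
  apply: (intble_eq (intbleD (intbleZ (F x) Ig) (intbleZ (- 1) IFg))) => t _.
  by rewrite mulN1r.
rewrite (le_trans (le_normr_Rintegral _ _))//; first exact: (intble_itv Id a0 bT).
rewrite -RintegralZl//; last exact: (intble_itv (intble_norm Ig) a0 bT).
apply: le_Rintegral => //.
- exact: (intble_itv (intble_norm Id) a0 bT).
- exact: (intble_itv (intbleZ eta (intble_norm Ig)) a0 bT).
- move=> t /=; rewrite in_itv/= => ht.
  by rewrite -mulrBl normrM ler_wpM2r// H.
Qed.

Lemma RS_sum_prim F G g a b s (xi : nat -> R) (eta : R) : ucont T F -> intble T g ->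
  (forall t, 0 <= t <= T -> G t = G 0 + prim g t) ->
  0 <= a -> b <= T -> itv_partition a b s ->
  (forall k, (k < size s)%N -> forall r,
     nth b (a :: s) k <= r <= nth b (a :: s) k.+1 -> `|F (xi k) - F r| <= eta) ->
  `|RS_sum F G a b s xi -
     (prim (fun t => F t * g t) b - prim (fun t => F t * g t) a)| <=
  eta * (prim (fun t => `|g t|) b - prim (fun t => `|g t|) a).
Proof.
move=> cF Ig Gg; elim: s a xi => [|c s ih] a xi a0 bT ps H.
  by rewrite (itv_partition_nil ps) /RS_sum big_geq// !subrr normr0 mulr0.
have ps' := itv_partition_cons ps.
have ac : a < c by case: ps => /= /andP[].
have cb := itv_partition_le ps'.
rewrite RS_sum_cons.
have h1 := @RS_step F G g a c (xi 0%N) eta cF Ig Gg.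
have {}h1 := h1 _ (le_trans cb bT) (H 0%N isT).
have {}h1 := h1 (introT andP (conj a0 (ltW ac))).
have h2 := ih c (xi \o S) (le_trans a0 (ltW ac)) bT ps' (fun k => H k.+1).
move: h1 h2; set A := prim _ c; set B := prim _ a; set C := prim _ b.
set A' := prim _ c; set B' := prim _ a; set C' := prim _ b.
set P := F _ * _; set Q := RS_sum _ _ _ _ _ _ => h1 h2.
have -> : P + Q - (C - B) = (P - (A - B)) + (Q - (C - A)) by ring.
have -> : eta * (C' - B') = eta * (A' - B') + eta * (C' - A') by ring.
exact: le_trans (ler_normD _ _) (lerD h1 h2).
Qed.

(** Riemann-Stieltjes integration against a primitive of [g] is Lebesgue
    integration against the density [g]. *)
Lemma is_RS_integral_prim F G g t : ucont T F -> intble T g ->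
  (forall t, 0 <= t <= T -> G t = G 0 + prim g t) -> 0 <= t <= T ->
  is_RS_integral F G 0 t (prim (fun t => F t * g t) t).
Proof.
move=> cF Ig Gg /andP[t0 tT] e e0.
set N := prim (fun t => `|g t|) t.
have N0 : 0 <= N by apply: prim_ge0.
have N1 : 0 < N + 1 by rewrite ltr_wpDl.
have [dl dl0 H] := cF _ (divr_gt0 e0 N1); exists dl => // s xi ps /= hs.
have := @RS_sum_prim F G g 0 t s xi (e / (N + 1)) cF Ig Gg (lexx _) tT ps.
rewrite !prim0 !subr0 -/N => h.
apply: (@le_lt_trans _ _ (e / (N + 1) * N)); last first.
  by rewrite -mulrA -[ltRHS]mulr1 ltr_pM2l// mulrC ltr_pdivrMr// mul1r ltrDl.
apply: h => k ks r /andP[r1 r2].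
have [h1 /andP[x1 x2]] := hs k ks.
have t1 : 0 <= nth t (0 :: s) k by exact: (itv_partition_nth_ge (leqW ks) ps).
have t2 : nth t (0 :: s) k.+1 <= T.
  exact: le_trans (itv_partition_nth_le (ks : (k.+1 < (size s).+1)%N) ps) tT.
apply/ltW/H.
- by rewrite (le_trans t1)// (le_trans x2).
- by rewrite (le_trans t1)// (le_trans r2).
- by rewrite ltr_norml; move: h1 x1 x2 r1 r2; lra.
Qed.

(** The product rule for primitives. The Riemann-Stieltjes sums of F dG tagged
    at the right endpoints and of G dF tagged at the left endpoints add up to
    F(t) G(t) - F(0) G(0) exactly. *)
Lemma prim_prod F G f g t : ucont T F -> ucont T G -> intble T f -> intble T g ->
  (forall t, 0 <= t <= T -> F t = F 0 + prim f t) ->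
  (forall t, 0 <= t <= T -> G t = G 0 + prim g t) -> 0 <= t <= T ->
  F t * G t = F 0 * G 0 + prim (fun t => F t * g t + G t * f t) t.
Proof.
move=> cF cG If Ig Ff Gg ht; have /andP[t0 tT] := ht.
have T0 := le_trans t0 tT.
rewrite (@primD _ T)//; [|exact: intbleM..].
have hF := is_RS_integral_prim cF Ig Gg ht; have hG := is_RS_integral_prim cG If Ff ht.
set I := prim _ t in hF *; set J := prim _ t in hG *.
apply/eqP; rewrite -subr_eq0 -normr_le0 leNgt; apply/negP.
set D := `|_| => D0.
have e2 : 0 < D / 2 by rewrite divr_gt0.
have [d1 d10 H1] := hF _ e2; have [d2 d20 H2] := hG _ e2.
have [|s ps hs] := @ex_itv_partition 0 t (Num.min d1 d2) t0; first by rewrite lt_min d10.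
pose x := nth t (0 :: s).
have xs k : (k < size s)%N -> x k <= x k.+1.
  by move=> ks; case: ps => /(pathP t) /(_ k ks) /ltW + _; exact.
have /= h1 := H1 s (x \o S) ps; have /= h2 := H2 s x ps.
have sumE : RS_sum F G 0 t s (x \o S) + RS_sum G F 0 t s x = F t * G t - F 0 * G 0.
  rewrite /RS_sum -big_split /=.
  rewrite (eq_bigr (fun k => F (x k.+1) * G (x k.+1) - F (x k) * G (x k))); last first.
    by move=> k _; rewrite /x /=; ring.
  rewrite (telescope_sumr (fun k => F (x k) * G (x k)))// /x.
  by rewrite (itv_partition_nth_size t ps).
have : D < D / 2 + D / 2; last by rewrite -splitr ltxx.
have DE : D = `|(RS_sum F G 0 t s (x \o S) - I) + (RS_sum G F 0 t s x - J)|.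
  by congr `|_|; rewrite addrACA sumE; ring.
rewrite [X in X < _]DE (le_lt_trans (ler_normD _ _))// ltrD//.
  apply: h1 => k ks; split; last by rewrite lexx andbT; exact: xs.
  by have := hs k ks; rewrite lt_min => /andP[].
apply: h2 => k ks; split; last by rewrite lexx; exact: xs.
by have := hs k ks; rewrite lt_min => /andP[].
Qed.

End Riemann_Stieltjes.

(** * Words and iterated integrals *)

Section Frobenius.
Context {R : realType}.

Lemma frob_sqr (q r : nat) (A : 'M[R]_(q, r)) :
  frob A ^+ 2 = \sum_i \sum_j A i j ^+ 2.
Proof.
by rewrite sqr_sqrtr// sumr_ge0// => i _; rewrite sumr_ge0// => j _; rewrite sqr_ge0.
Qed.

Lemma frob_ge0 (q r : nat) (A : 'M[R]_(q, r)) : 0 <= frob A.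
Proof. exact: sqrtr_ge0. Qed.

Lemma entry_sqr_le_frob (q r : nat) (A : 'M[R]_(q, r)) i j : A i j ^+ 2 <= frob A ^+ 2.
Proof.
rewrite frob_sqr (bigD1 i)//= (bigD1 j)//= -addrA lerDl addr_ge0// sumr_ge0// => *.
  exact: sqr_ge0.
by rewrite sumr_ge0// => *; exact: sqr_ge0.
Qed.

Lemma entry_le_frob (q r : nat) (A : 'M[R]_(q, r)) i j : `|A i j| <= frob A.
Proof.
rewrite -(@ler_pXn2r _ 2)// ?nnegrE ?frob_ge0//.
by rewrite real_normK ?num_real// entry_sqr_le_frob.
Qed.

(** The Euclidean norm is at most the l^1 norm. *)
Lemma frob_cV_le (q : nat) (v : 'cV[R]_q) : frob v <= \sum_i `|v i 0|.
Proof.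
have s0 : 0 <= \sum_i `|v i 0| by rewrite sumr_ge0.
rewrite -(@ler_pXn2r _ 2)// ?nnegrE ?frob_ge0//.
rewrite frob_sqr expr2 mulr_suml ler_sum// => i _.
rewrite big_ord1 -real_normK ?num_real// expr2 ler_wpM2l//.
by rewrite (bigD1 i)//= lerDl sumr_ge0.
Qed.

End Frobenius.

Section words.
Context {R : realType} {m : nat} {T : R}.
Hypothesis T_ge0 : 0 <= T.
Implicit Types (u : L2 m T) (t : R) (j : 'I_m.+1) (w v : seq 'I_m.+1).

(** The components of the derivative (1, u) of the path t |-> (t, U(t)). *)
Definition drive u j t : R := (col_mx (1%:M : 'M[R]_1) (u t) : 'cV[R]_m.+1) j 0.

Lemma drive0 u t : drive u ord0 t = 1.
Proof.
transitivity (col_mx (1%:M : 'M[R]_1) (u t) (lshift m ord0) 0).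
  by rewrite /drive; congr (col_mx _ _ _ _); exact/val_inj.
by rewrite col_mxEu mxE.
Qed.

Lemma driveS u (i : 'I_m) t : drive u (rshift 1 i : 'I_(1 + m)) t = u t i 0.
Proof. exact: col_mxEd. Qed.

Lemma drive_case (P : 'I_m.+1 -> Prop) : P ord0 ->
  (forall i : 'I_m, P (rshift 1 i : 'I_(1 + m))) -> forall j, P j.
Proof.
move=> P0 PS j; case: (split_ordP (j : 'I_(1 + m))) => i ->; last exact: PS.
by have -> : lshift m i = ord0 :> 'I_m.+1 by apply/val_inj; rewrite /= (ord1 i).
Qed.

Lemma intble_L2 u (i : 'I_m) : intble T (fun t => u t i 0).
Proof.
apply: (@intble_le _ T _ (fun t => 1 + frob (u t) ^+ 2)).
- exact: L2_measurable.
- apply: intbleD; [exact: intble_cst|exact: L2_integrable].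
move=> t _ /=; apply: (@le_trans _ _ (1 + u t i 0 ^+ 2)); last first.
  by rewrite lerD2l entry_sqr_le_frob.
by rewrite -[u t i 0 ^+ 2]real_normK ?num_real//; nra.
Qed.

Lemma intble_drive u j : intble T (drive u j).
Proof.
elim/drive_case: j => [|i].
  by apply: (intble_eq (intble_cst T 1)) => t _; rewrite drive0.
by apply: (intble_eq (intble_L2 u i)) => t _; rewrite driveS.
Qed.

Lemma augmented_pathE u j t : 0 <= t <= T ->
  augmented_path u t j 0 = prim (drive u j) t.
Proof.
move=> /andP[t0 tT]; rewrite /augmented_path; elim/drive_case: j => [|i].
  rewrite (@eq_prim _ T _ (fun=> 1) t tT) => [|s _]; last by rewrite drive0.
  rewrite prim_cst// mul1r.
  transitivity (col_mx (t%:M : 'M[R]_1) (vint 0 t u) (lshift m ord0) 0).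
    by congr (col_mx _ _ _ _); exact/val_inj.
  by rewrite col_mxEu mxE.
rewrite (@eq_prim _ T _ (fun s => u s i 0) t tT) => [|s _]; last by rewrite driveS.
by rewrite [LHS]col_mxEd mxE.
Qed.

(** The iterated integral along a word of letters. The head of the word is the
    letter integrated last, so that words are read from the largest variable
    down. *)
Fixpoint word_integral u w : R -> R :=
  match w with
  | [::] => fun=> 1
  | j :: w' => prim (fun s => word_integral u w' s * drive u j s)
  end.

Lemma ucont_word u w : ucont T (word_integral u w).
Proof.
elim: w => [|j w ih]; first exact: ucont_cst.
by apply: ucont_prim => //; apply: intbleM => //; exact: intble_drive.
Qed.

Lemma intble_word u w j : intble T (fun s => word_integral u w s * drive u j s).
Proof. by apply: intbleM => //; [exact: ucont_word|exact: intble_drive]. Qed.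

(** The recursive form of the shuffle identity. *)
Lemma shuffle_words u j w i v t : 0 <= t <= T ->
  word_integral u (j :: w) t * word_integral u (i :: v) t =
  prim (fun s => (word_integral u (j :: w) s * word_integral u v s) * drive u i s) t +
  prim (fun s => (word_integral u w s * word_integral u (i :: v) s) * drive u j s) t.
Proof.
move=> ht; have /andP[t0 tT] := ht.
rewrite -(@primD _ T)//; last 2 first.
  by apply: intbleM (intble_drive u i) => //; apply: ucontM => //; exact: ucont_word.
  by apply: intbleM (intble_drive u j) => //; apply: ucontM => //; exact: ucont_word.
rewrite (prim_prod (ucont_word u (j :: w)) (ucont_word u (i :: v))
   (intble_word u w j) (intble_word u v i))//=.
- rewrite !prim0 mul0r add0r; apply: (@eq_prim _ T) => // s _; ring.
- by move=> s _; rewrite prim0 add0r.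
- by move=> s _; rewrite prim0 add0r.
Qed.

(** The linear combination of iterated integrals with the given coefficients. *)
Definition sigcomb (l : seq (R * seq 'I_m.+1)) u t : R :=
  \sum_(cw <- l) cw.1 * word_integral u cw.2 t.

(** The signature functionals: families, indexed by the controls, that coincide
    on [0, T] with a fixed linear combination of iterated integrals. *)
Definition sigfun (a : L2 m T -> R -> R) := exists l, forall u t, 0 <= t <= T ->
  a u t = sigcomb l u t.

Implicit Types a b : L2 m T -> R -> R.

Lemma sigfun_eq a b : sigfun a ->
  (forall u t, 0 <= t <= T -> a u t = b u t) -> sigfun b.
Proof. by move=> [l H] ab; exists l => u t ht; rewrite -ab// H. Qed.

Lemma sigfun_word w : sigfun (fun u => word_integral u w).
Proof. by exists [:: (1, w)] => u t _; rewrite /sigcomb big_seq1 mul1r. Qed.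

Lemma sigfunD a b : sigfun a -> sigfun b -> sigfun (fun u t => a u t + b u t).
Proof.
move=> [l H] [l' H']; exists (l ++ l') => u t ht.
by rewrite /sigcomb big_cat/= H// H'.
Qed.

Lemma sigfunZ (c : R) a : sigfun a -> sigfun (fun u t => c * a u t).
Proof.
move=> [l H]; exists [seq (c * cw.1, cw.2) | cw <- l] => u t ht.
rewrite /sigcomb big_map H// /sigcomb mulr_sumr.
by apply: eq_bigr => cw _ /=; rewrite mulrA.
Qed.

Lemma sigfun_cst (c : R) : sigfun (fun _ _ => c).
Proof.
by apply: (sigfun_eq (sigfunZ c (sigfun_word [::]))) => u t _; rewrite /= mulr1.
Qed.

Lemma sigfun_sum I (r : seq I) (a : I -> L2 m T -> R -> R) :
  (forall i, sigfun (a i)) -> sigfun (fun u t => \sum_(i <- r) a i u t).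
Proof.
move=> H; elim: r => [|i r ih].
  by apply: (sigfun_eq (sigfun_cst 0)) => u t _; rewrite big_nil.
by apply: (sigfun_eq (sigfunD (H i) ih)) => u t _; rewrite big_cons.
Qed.

Lemma sigfun_ucont a u : sigfun a -> ucont T (a u).
Proof.
move=> [l H]; apply: (@ucont_eq _ _ (sigcomb l u)) => [|t ht]; last by rewrite H.
by apply: ucont_sum => // cw; apply: ucontZ; exact: ucont_word.
Qed.

(** Integration against the letter [j] prepends [j] to the words. *)
Lemma sigfun_prim a j : sigfun a ->
  sigfun (fun u => prim (fun s => a u s * drive u j s)).
Proof.
move=> [l H]; exists [seq (cw.1, j :: cw.2) | cw <- l] => u t /andP[t0 tT].
rewrite (@eq_prim _ T _
  (fun s => \sum_(cw <- l) cw.1 * (word_integral u cw.2 s * drive u j s)) t tT).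
  rewrite (@prim_sum _ T)//; last by move=> cw; apply: intbleZ; exact: intble_word.
  rewrite /sigcomb big_map; apply: eq_bigr => cw _.
  by rewrite (@primZ _ T)//; exact: intble_word.
move=> s hs; rewrite H// /sigcomb mulr_suml.
by apply: eq_bigr => cw _; rewrite mulrA.
Qed.

Lemma sigfun_word_mul w v :
  sigfun (fun u t => word_integral u w t * word_integral u v t).
Proof.
have [n] := ubnP (size w + size v); elim: n w v => // n ih [|j w] v.
  move=> _; apply: (sigfun_eq (sigfun_word v)) => u t _; by rewrite mul1r.
case: v => [|i v] h.
  by apply: (sigfun_eq (sigfun_word (j :: w))) => u t _; rewrite mulr1.
have h1 := sigfun_prim i (ih (j :: w) v _); have h2 := sigfun_prim j (ih w (i :: v) _).
apply: (sigfun_eq (sigfunD (h1 _) (h2 _))) => [||u t ht].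
- by move: h => /=; lia.
- by move: h => /=; lia.
- by rewrite shuffle_words.
Qed.

Lemma sigfunM a b : sigfun a -> sigfun b -> sigfun (fun u t => a u t * b u t).
Proof.
move=> [l H] [l' H'].
apply: (@sigfun_eq (fun u t => \sum_(cw <- l) \sum_(cv <- l')
   (cw.1 * cv.1) * (word_integral u cw.2 t * word_integral u cv.2 t))).
  apply: sigfun_sum => cw; apply: sigfun_sum => cv; apply: sigfunZ.
  exact: sigfun_word_mul.
move=> u t ht; rewrite H// H'// /sigcomb mulr_suml; apply: eq_bigr => cw _.
by rewrite mulr_sumr; apply: eq_bigr => cv _; ring.
Qed.

(** Each iterated integral along a word is a coordinate of the tensor of the
    corresponding order. *)
Lemma iterated_integral_word w : exists i : 'I_(m.+1 ^ size w),
  forall u t, 0 <= t <= T ->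
    iterated_integral (augmented_path u) (size w) 0 t i 0 = word_integral u w t.
Proof.
elim: w => [|j w [i ih]]; first by exists ord0 => u t _; rewrite /= mxE.
exists (cast_ord (esym (expnSr m.+1 (size w))) (mxvec_index i j)) => u t ht.
rewrite [iterated_integral _ _ _ _]/= castmxE /= cast_ord_id.
rewrite /kron_integral mxE (_ : cast_ord _ _ = mxvec_index i j); last exact/val_inj.
rewrite mxvecE mxE; have /andP[t0 tT] := ht.
apply: RS_integralE => //.
have E s : 0 <= s <= T ->
   iterated_integral (augmented_path u) (size w) 0 s i 0 = word_integral u w s.
  exact: ih.
rewrite (@eq_prim _ T _ (fun s => iterated_integral (augmented_path u) (size w) 0 s i 0
  * drive u j s) t tT); last by move=> s hs; rewrite E.
apply: (@is_RS_integral_prim _ T) => //; last 2 first.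
- exact: intble_drive.
- move=> s hs; rewrite !augmented_pathE ?lexx// ?(le_trans t0)//.
  by rewrite prim0 add0r.
- by apply: (ucont_eq (ucont_word u w)) => s hs; rewrite E.
Qed.

Lemma sigfun_signature (N : nat) w : (size w <= N)%N ->
  exists s : 'I_(\sum_(k < N.+1) m.+1 ^ k), forall u t, 0 <= t <= T ->
    signature (augmented_path u) N 0 t s 0 = word_integral u w t.
Proof.
rewrite -ltnS => wN; have [i H] := iterated_integral_word w.
exists (@tagnat.Rank _ (fun k : 'I_N.+1 => (m.+1 ^ k)%N) (Ordinal wN) i) => u t ht.
rewrite -H// /signature.
have := mxcolK (fun k : 'I_N.+1 => iterated_integral (augmented_path u) k 0 t) (Ordinal wN).
by move=> /matrixP/(_ i 0); rewrite mxE.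
Qed.

(** Finitely many signature functionals are the coordinates of C S^N for a
    common order N, namely the maximal length of the words involved. *)
Lemma sigcomb_signature (p : nat) (l : 'I_p -> seq (R * seq 'I_m.+1)) :
  exists N (C : 'M[R]_(p, \sum_(k < N.+1) m.+1 ^ k)), forall u t, 0 <= t <= T ->
    C *m signature (augmented_path u) N 0 t = \col_i sigcomb (l i) u t.
Proof.
pose N := \max_(i < p) \max_(cw <- l i) size cw.2.
have row i : exists C : 'rV[R]_(\sum_(k < N.+1) m.+1 ^ k), forall u t, 0 <= t <= T ->
    (C *m signature (augmented_path u) N 0 t) 0 0 = sigcomb (l i) u t.
  have : forall cw, cw \in l i -> (size cw.2 <= N)%N.
    move=> cw cwl; apply: leq_trans (leq_bigmax i).
    exact: (@leq_bigmax_seq _ (l i) xpredT (fun cw => size cw.2)).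
  elim: (l i) => [_|[c w] l' ih H].
    by exists 0 => u t _; rewrite mul0mx mxE /sigcomb big_nil.
  have [|C HC] := ih; first by move=> cw cwl; apply: H; rewrite inE cwl orbT.
  have [|s Hs] := @sigfun_signature N w; first by apply: (H (c, w)); rewrite mem_head.
  exists (c *: delta_mx 0 s + C) => u t ht.
  rewrite mulmxDl mxE HC// /sigcomb big_cons; congr (_ + _).
  by rewrite -scalemxAl mxE -rowE mxE Hs.
have [Cf HC] := choice row.
exists N, (\matrix_i Cf i) => u t ht.
apply/matrixP => i k; rewrite ord1 [RHS]mxE -HC// !mxE.
by apply: eq_bigr => s _; rewrite mxE.
Qed.

End words.

(** * Uniform limits of signature functionals *)

Section uniform_closure.
Context {R : realType} {m : nat} {T : R}.
Hypothesis T_ge0 : 0 <= T.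
Variables (K : set (L2 m T)) (H : R).
Hypothesis KH : forall u, K u -> prim (fun t => \sum_j `|drive u j t|) T <= H.
Implicit Types (u : L2 m T) (t : R) (j : 'I_m.+1) (a b : L2 m T -> R -> R).

Lemma intble_drive_sum u : intble T (fun t => \sum_j `|drive u j t|).
Proof. by apply: intble_sum => j; apply: intble_norm; exact: intble_drive. Qed.

Lemma prim_drive_le u j t : K u -> 0 <= t <= T -> prim (fun t => `|drive u j t|) t <= H.
Proof.
move=> Ku ht; have /andP[t0 tT] := ht; apply: le_trans (KH Ku).
apply: (@le_trans _ _ (prim (fun t => \sum_j `|drive u j t|) t)).
  apply: (prim_le _ (intble_drive_sum u) tT); first exact/intble_norm/intble_drive.
  by move=> s _; rewrite (bigD1 j)//= lerDl sumr_ge0.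
apply: (prim_mono (intble_drive_sum u)) => // r _; exact: sumr_ge0.
Qed.

Lemma prim_mul_drive_le u j t (F : R -> R) M : K u -> 0 <= t <= T -> ucont T F ->
  (forall s, 0 <= s <= t -> `|F s| <= M) ->
  `|prim (fun s => F s * drive u j s) t| <= M * H.
Proof.
move=> Ku ht cF FM; have /andP[t0 tT] := ht.
have Id := intble_drive u j; have IFd := intbleM T_ge0 cF Id.
have M0 : 0 <= M by apply: le_trans (FM 0 _); rewrite ?lexx.
apply: (le_trans (prim_norm IFd tT)).
apply: (@le_trans _ _ (prim (fun s => M * `|drive u j s|) t)).
  apply: (prim_le (intble_norm IFd) (intbleZ M (intble_norm Id)) tT) => s hs.
  by rewrite normrM ler_wpM2r// FM.
by rewrite (primZ _ (intble_norm Id))// ler_wpM2l// prim_drive_le.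
Qed.

Lemma word_bounded w : exists M, forall u t, K u -> 0 <= t <= T ->
  `|word_integral u w t| <= M.
Proof.
elim: w => [|j w [M HM]]; first by exists 1 => u t _ _; rewrite normr1.
exists (M * H) => u t Ku ht; have /andP[t0 tT] := ht.
apply: prim_mul_drive_le => //; first exact: ucont_word.
by move=> s /andP[s0 st]; rewrite HM// s0 (le_trans st).
Qed.

Lemma sigfun_bounded a : sigfun a -> exists2 M, 0 < M & forall u t, K u -> 0 <= t <= T ->
  `|a u t| <= M.
Proof.
move=> [l Hl].
suff [M HM] : exists M, forall u t, K u -> 0 <= t <= T -> `|sigcomb l u t| <= M.
  exists (`|M| + 1); first by rewrite ltr_wpDl.
  move=> u t Ku ht; rewrite Hl// (le_trans (HM _ _ Ku ht))//.
  by rewrite (le_trans (ler_norm _))// lerDl.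
elim: l {Hl} => [|[c w] l [M HM]].
  by exists 0 => u t _ _; rewrite /sigcomb big_nil normr0.
have [M' HM'] := word_bounded w.
exists (`|c| * M' + M) => u t Ku ht; rewrite /sigcomb big_cons.
rewrite (le_trans (ler_normD _ _))// lerD//; last exact: HM.
by rewrite normrM ler_wpM2l// HM'.
Qed.

(** Uniform limits of signature functionals on K x [0, T]. Continuity in time,
    which a uniform limit inherits, is recorded for convenience. *)
Definition sigapprox a := (forall u, K u -> ucont T (a u)) /\
  forall e : R, 0 < e -> exists2 b, sigfun b &
    forall u t, K u -> 0 <= t <= T -> `|a u t - b u t| <= e.

Lemma sigapprox_eq a b : sigapprox a ->
  (forall u t, K u -> 0 <= t <= T -> a u t = b u t) -> sigapprox b.
Proof.
move=> [ca ha] ab; split=> [u Ku|e e0].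
  by apply: (ucont_eq (ca u Ku)) => t ht; rewrite ab.
by have [c sc hc] := ha e e0; exists c => // u t Ku ht; rewrite -ab// hc.
Qed.

Lemma sigapprox_cst (c : R) : sigapprox (fun _ _ => c).
Proof.
split=> [u _|e e0]; first exact: ucont_cst.
exists (fun _ _ => c); first exact: sigfun_cst.
by move=> u t _ _; rewrite subrr normr0 ltW.
Qed.

Lemma sigapproxD a b : sigapprox a -> sigapprox b ->
  sigapprox (fun u t => a u t + b u t).
Proof.
move=> [ca ha] [cb hb]; split=> [u Ku|e e0].
  exact: ucontD (ca u Ku) (cb u Ku).
have e2 : 0 < e / 2 by rewrite divr_gt0.
have [a' sa' ha'] := ha _ e2; have [b' sb' hb'] := hb _ e2.
exists (fun u t => a' u t + b' u t); first exact: sigfunD.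
move=> u t Ku ht; rewrite opprD addrACA [e]splitr.
by rewrite (le_trans (ler_normD _ _))// lerD ?ha' ?hb'.
Qed.

Lemma sigapproxZ (c : R) a : sigapprox a -> sigapprox (fun u t => c * a u t).
Proof.
move=> [ca ha]; split=> [u Ku|e e0]; first exact: ucontZ (ca u Ku).
have c0 : 0 < `|c| + 1 by rewrite ltr_wpDl.
have [a' sa' ha'] := ha _ (divr_gt0 e0 c0).
exists (fun u t => c * a' u t); first exact: sigfunZ.
move=> u t Ku ht; rewrite -mulrBr normrM.
have := ha' u t Ku ht; rewrite ler_pdivlMr// mulrC; apply: le_trans.
by rewrite ler_wpM2r// lerDl.
Qed.

Lemma sigapprox_sum I (r : seq I) (a : I -> L2 m T -> R -> R) :
  (forall i, sigapprox (a i)) -> sigapprox (fun u t => \sum_(i <- r) a i u t).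
Proof.
move=> Ha; elim: r => [|i r ih].
  by apply: (sigapprox_eq (sigapprox_cst 0)) => u t _ _; rewrite big_nil.
by apply: (sigapprox_eq (sigapproxD (Ha i) ih)) => u t _ _; rewrite big_cons.
Qed.

Lemma sigapprox_prim a j : sigapprox a ->
  sigapprox (fun u => prim (fun s => a u s * drive u j s)).
Proof.
move=> [ca ha]; split=> [u Ku|e e0].
  by apply: ucont_prim => //; apply: intbleM (ca u Ku) (intble_drive u j).
have H1 : 0 < `|H| + 1 by rewrite ltr_wpDl.
have [a' sa' ha'] := ha _ (divr_gt0 e0 H1).
exists (fun u => prim (fun s => a' u s * drive u j s)); first exact: sigfun_prim.
move=> u t Ku ht; have /andP[t0 tT] := ht.
have ca' := sigfun_ucont T_ge0 u sa'; have Id := intble_drive u j.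
rewrite -(primB (intbleM T_ge0 (ca u Ku) Id) (intbleM T_ge0 ca' Id) tT).
under [X in prim X _]eq_fun do rewrite -mulrBl.
apply: (@le_trans _ _ (e / (`|H| + 1) * H)).
  apply: prim_mul_drive_le => //.
    apply: (ucont_eq (ucontD (ca u Ku) (ucontZ (- 1) ca'))) => s _.
    by rewrite mulN1r.
  by move=> s /andP[s0 st]; apply: ha' => //; rewrite s0 (le_trans st).
rewrite mulrAC ler_pdivrMr// ler_wpM2l ?ltW//.
by rewrite (le_lt_trans (ler_norm _))// ltrDl.
Qed.

(** The classical polynomial iteration p + (x^2 - p^2) / 2, which increases to
    the absolute value of [x] when [x] lies in [-1, 1]. *)
Fixpoint abs_iter (x : R) (n : nat) : R :=
  if n is n'.+1 then abs_iter x n' + (x ^+ 2 - abs_iter x n' ^+ 2) / 2 else 0.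

(** The error z at rank n satisfies z' <= z (1 - z / 2), hence decays like
    2 / (n + 2). *)
Lemma abs_iterP (x : R) n : `|x| <= 1 ->
  0 <= abs_iter x n <= `|x| /\ `|x| - abs_iter x n <= 2 / n.+2%:R.
Proof.
move=> x1; elim: n => [|n [/andP[p0 px] pn]] /=.
  by rewrite lexx normr_ge0 subr0 divff ?pnatr_eq0.
have -> : x ^+ 2 = `|x| ^+ 2 by rewrite real_normK ?num_real.
have x0 := normr_ge0 x; move: x1 x0 p0 px pn.
set y := `|x|; set q := abs_iter x n => y1 y0 q0 qy qn.
have E : y - (q + (y ^+ 2 - q ^+ 2) / 2) = (y - q) * (1 - (y + q) / 2) by field.
split.
  apply/andP; split; first by nra.
  by rewrite -subr_ge0 E mulr_ge0 ?subr_ge0//; lra.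
have n2 : (2 : R) <= n.+2%:R by rewrite ler_nat.
have n3 : (0 : R) < n.+3%:R by rewrite ltr0n.
rewrite E ler_pdivlMr//.
have -> : n.+3%:R = n.+2%:R + 1 :> R by rewrite natr1.
move: qn; rewrite ler_pdivlMr ?ltr0n//; move: n2; set N : R := n.+2%:R => n2 qn.
set z := y - q in qn *.
have z0 : 0 <= z by rewrite subr_ge0.
have zy : z <= y + q by rewrite /z; lra.
have h1 : z * (1 - (y + q) / 2) <= z * (1 - z / 2) by apply: ler_wpM2l => //; lra.
apply: (@le_trans _ _ (z * (1 - z / 2) * (N + 1))); first by rewrite ler_wpM2r//; lra.
have N0 : 0 < N by lra.
(* Equivalent to the bound on z (1 - z / 2) after clearing denominators; it uses
   z N <= 2 <= N. *)
have key : 0 <= (2 - z * N) * (N - 1 - z * N / 2) * (N + 1).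
  by rewrite !mulr_ge0//; lra.
rewrite -(ler_pM2r (exprn_gt0 2 N0)) -subr_ge0.
have -> : 2 * N ^+ 2 - z * (1 - z / 2) * (N + 1) * N ^+ 2 =
  2 + (2 - z * N) * (N - 1 - z * N / 2) * (N + 1) by field.
by rewrite addr_ge0.
Qed.

Lemma sigfun_abs_iter b n : sigfun b -> sigfun (fun u t => abs_iter (b u t) n).
Proof.
move=> sb; elim: n => [|n ih] /=; first exact: sigfun_cst.
have s2 := sigfunD (sigfunM T_ge0 sb sb) (sigfunZ (- 1) (sigfunM T_ge0 ih ih)).
apply: (sigfun_eq (sigfunD ih (sigfunZ 2^-1 s2))) => u t _; by field.
Qed.

Lemma sigapprox_norm a : sigapprox a -> sigapprox (fun u t => `|a u t|).
Proof.
move=> [ca ha]; split=> [u Ku|e e0]; first exact: ucont_norm (ca u Ku).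
have e2 : 0 < e / 2 by rewrite divr_gt0.
have [b sb hb] := ha _ e2; have [M M0 HM] := sigfun_bounded sb.
pose n := Num.truncn (4 * M / e).
(* Rescaling by the bound M brings the values into [-1, 1]. *)
exists (fun u t => M * abs_iter (M^-1 * b u t) n).
  exact/sigfunZ/sigfun_abs_iter/sigfunZ.
move=> u t Ku ht.
have Mb : `|M^-1 * b u t| <= 1.
  by rewrite normrM gtr0_norm ?invr_gt0// mulrC ler_pdivrMr// mul1r HM.
have [/andP[_ h1] h2] := abs_iterP n Mb.
set q := abs_iter _ n in h1 h2 *.
have -> : `|a u t| - M * q = (`|a u t| - `|b u t|) + M * (`|M^-1 * b u t| - q).
  rewrite normrM (gtr0_norm (_ : 0 < M^-1)) ?invr_gt0//; field; exact: lt0r_neq0.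
rewrite [e]splitr (le_trans (ler_normD _ _))// lerD//.
  by rewrite (le_trans (ler_dist_dist _ _))// hb.
rewrite normrM (gtr0_norm M0) ger0_norm ?subr_ge0//.
rewrite (le_trans (ler_wpM2l (ltW M0) h2))//.
have nb : 4 * M / e < n.+1%:R by exact: truncnS_gt.
rewrite mulrA ler_pdivrMr ?ltr0n//; move: nb; rewrite ltr_pdivrMr// -[n.+2%:R]natr1.
by nra.
Qed.

Lemma sigapprox_min a b : sigapprox a -> sigapprox b ->
  sigapprox (fun u t => Num.min (a u t) (b u t)).
Proof.
move=> sa sb.
have h := sigapprox_norm (sigapproxD sa (sigapproxZ (- 1) sb)).
apply: (sigapprox_eq (sigapproxZ 2^-1
  (sigapproxD (sigapproxD sa sb) (sigapproxZ (- 1) h)))) => u t _ _.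
rewrite !mulN1r; case: leP => ab.
  by rewrite ler0_norm ?subr_le0//; field.
by rewrite gtr0_norm ?subr_gt0//; field.
Qed.

End uniform_closure.

(** * Lipschitz functions as minima of cones *)

Section McShane.
Context {R : realType} {d : nat}.
Implicit Types (x y z : 'cV[R]_d) (g : 'cV[R]_d -> R) (Z : seq 'cV[R]_d).

(** The l^1 distance. *)
Definition dist1 x y : R := \sum_i `|x i 0 - y i 0|.

(** The cube of half-width [M] centred at 0. *)
Definition box (M : R) x := forall i, `|x i 0| <= M.

(** The cone of slope [L] with apex (z, g z). *)
Definition cone g (L : R) z x : R := g z + L * dist1 x z.

(** The minimum of the cones of [g] with apexes over the points of [z0 :: Z]. *)
Definition mcshane g (L : R) z0 Z x : R :=
  foldr (fun z => Num.min (cone g L z x)) (cone g L z0 x) Z.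

Lemma dist1_ge0 x y : 0 <= dist1 x y.
Proof. exact: sumr_ge0. Qed.

Lemma dist1C x y : dist1 x y = dist1 y x.
Proof. by apply: eq_bigr => i _; rewrite distrC. Qed.

Lemma dist1_triangle y x z : dist1 x z <= dist1 x y + dist1 y z.
Proof.
rewrite /dist1 -big_split ler_sum// => i _.
by rewrite (le_trans _ (ler_normD _ _))// addrA subrK.
Qed.

Lemma mcshane_le g L z0 Z x z : z \in z0 :: Z -> mcshane g L z0 Z x <= cone g L z x.
Proof.
elim: Z => [|z1 Z ih]; first by rewrite inE => /eqP ->.
rewrite !inE orbCA ge_min => /orP[/eqP ->|h]; first by rewrite lexx.
by rewrite ih ?orbT.
Qed.

Lemma mcshane_ge g L z0 Z x c : (forall z, z \in z0 :: Z -> c <= cone g L z x) ->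
  c <= mcshane g L z0 Z x.
Proof.
elim: Z => [|z1 Z ih] h; first by apply: h; rewrite mem_head.
rewrite /= le_min h ?inE ?eqxx ?orbT//=; apply: ih => z.
by rewrite inE => /orP[hz|hz]; apply: h; rewrite !inE hz ?orbT.
Qed.

Lemma mcshane_lipschitz g L z0 Z x y : 0 <= L ->
  `|mcshane g L z0 Z x - mcshane g L z0 Z y| <= L * dist1 x y.
Proof.
move=> L0.
suff main x' y' : mcshane g L z0 Z x' - mcshane g L z0 Z y' <= L * dist1 x' y'.
  by rewrite ler_norml -[- _ <= _]lerN2 opprK opprB main andbT dist1C main.
rewrite lerBlDr -lerBlDl; apply: mcshane_ge => z hz.
rewrite lerBlDl (le_trans (mcshane_le _ _ _ hz))// /cone addrCA lerD2l -mulrDr.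
by rewrite ler_wpM2l// dist1_triangle.
Qed.

(** A regular grid of mesh 2 M / (n + 1) in the cube. *)
Lemma finite_net (M e : R) : 0 < M -> 0 < e -> exists z0 Z,
  (forall z, z \in z0 :: Z -> box M z) /\
  (forall x, box M x -> exists2 z, z \in z0 :: Z & dist1 x z <= e).
Proof.
move=> M0 e0; pose n := Num.truncn (2 * M * d%:R / e).
have N0 : (0 : R) < n.+1%:R by rewrite ltr0n.
pose s : R := 2 * M / n.+1%:R.
have s0 : 0 < s by rewrite divr_gt0// mulr_gt0.
have sn : s * n.+1%:R = 2 * M by rewrite mulfVK// gt_eqF.
have sd : d%:R * s <= e.
  have nb : 2 * M * d%:R / e < n.+1%:R by exact: truncnS_gt.
  move: nb; rewrite ltr_pdivrMr// => nb.
  by rewrite /s mulrA ler_pdivrMr// [leLHS]mulrC [leRHS]mulrC ltW.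
pose pt (k : {ffun 'I_d -> 'I_n.+2}) : 'cV[R]_d := \col_i (- M + (k i)%:R * s).
exists (pt [ffun=> ord0]), [seq pt k | k : {ffun 'I_d -> 'I_n.+2}]; split.
  have pb k : box M (pt k).
    move=> i; rewrite mxE ler_norml lerDl mulr_ge0 ?(ltW s0) ?ler0n//=.
    have : (k i)%:R * s <= n.+1%:R * s by rewrite ler_pM2r// ler_nat -ltnS.
    by rewrite [n.+1%:R * s]mulrC sn; lra.
  by move=> z; rewrite inE => /orP[/eqP -> //|/mapP[k _ ->]].
move=> x xM.
have kb i : (Num.truncn ((x i 0 + M) / s)%R < n.+2)%N.
  have := xM i; rewrite ler_norml => /andP[x1 x2].
  rewrite ltnS truncn_le_nat ltr_pdivrMr// -natr1 mulrDl mul1r (mulrC _ s) sn.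
  by lra.
exists (pt [ffun i => Ordinal (kb i)]).
  by rewrite inE; apply/orP; right; apply/mapP; eexists => //; rewrite mem_enum.
apply: le_trans sd; rewrite /dist1 mulr_natl -[X in _ *+ X](card_ord d) -sumr_const.
apply: ler_sum => i _; rewrite mxE ffunE /=.
have := xM i; rewrite ler_norml => /andP[x1 x2].
have y0 : 0 <= (x i 0 + M) / s by rewrite divr_ge0 ?(ltW s0)//; lra.
have /andP[] := truncn_itv y0; set q : R := (Num.truncn _)%:R.
rewrite ler_pdivlMr// ltr_pdivrMr// -natr1 -/q mulrDl mul1r => h1 h2.
by rewrite ler_norml; apply/andP; split; lra.
Qed.

Lemma mcshane_approx g (M L e : R) : 0 < M -> 0 <= L -> 0 < e ->
  (forall x y, box M x -> box M y -> `|g x - g y| <= L * dist1 x y) ->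
  exists z0 Z, forall x, box M x -> `|g x - mcshane g L z0 Z x| <= e.
Proof.
move=> M0 L0 e0 gL; have L1 : 0 < 2 * L + 1 by rewrite ltr_wpDl// mulr_ge0.
have [z0 [Z [Zb Zn]]] := finite_net M0 (divr_gt0 e0 L1).
exists z0, Z => x xM; have [z zZ xz] := Zn x xM.
(* All the cones lie above g on the box, and the one at a nearby z is close to
   g at x. *)
have h1 : g x <= mcshane g L z0 Z x.
  apply: mcshane_ge => z' hz'; rewrite -lerBlDl.
  by rewrite (le_trans (ler_norm _))// gL//; exact: Zb.
have h2 : mcshane g L z0 Z x <= g x + 2 * L * dist1 x z.
  rewrite (le_trans (mcshane_le _ _ _ zZ))// /cone.
  have := gL z x (Zb _ zZ) xM; rewrite dist1C => /(le_trans (ler_norm _)).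
  lra.
have h3 : 2 * L * dist1 x z <= e.
  apply: (@le_trans _ _ ((2 * L + 1) * (e / (2 * L + 1)))).
    by rewrite ler_pM ?dist1_ge0 ?mulr_ge0// lerDl.
  by rewrite mulrC mulfVK// gt_eqF.
by rewrite ler_norml; apply/andP; split; lra.
Qed.

Lemma sigapprox_mcshane (m : nat) (T : R) (T_ge0 : 0 <= T) (K : set (L2 m T)) (H : R)
    (KH : forall u, K u -> prim (fun t => \sum_j `|drive u j t|) T <= H)
    g L z0 Z (a : L2 m T -> R -> 'cV[R]_d) :
  (forall i, sigapprox K (fun u t => a u t i 0)) ->
  sigapprox K (fun u t => mcshane g L z0 Z (a u t)).
Proof.
move=> sa.
have sc z : sigapprox K (fun u t => cone g L z (a u t)).
  apply: sigapproxD; first exact: sigapprox_cst.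
  apply: sigapproxZ; apply: sigapprox_sum => i.
  apply: (sigapprox_norm T_ge0 KH); apply: sigapproxD => //; exact: sigapprox_cst.
by elim: Z => [|z Z ih] //=; exact: (sigapprox_min T_ge0 KH).
Qed.

End McShane.

(** * Gronwall inequalities *)

Section Gronwall.
Context {R : realType} {T : R}.
Hypothesis T_ge0 : 0 <= T.
Implicit Types (s t : R).

(** The n-th term of the exponential series at the primitive of [k]. *)
Definition prim_exp_coeff (k : R -> R) (n : nat) t : R := prim k t ^+ n / n`!%:R.

Variable k : R -> R.
Hypothesis k_int : intble T k.
Hypothesis k_ge0 : forall t, 0 <= t <= T -> 0 <= k t.

Lemma ucont_prim_exp_coeff n : ucont T (prim_exp_coeff k n).
Proof.
have cX : ucont T (fun t => prim k t ^+ n).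
  elim: n => [|n ih]; first exact: ucont_cst.
  by apply: (ucont_eq (ucontM T_ge0 (ucont_prim k_int) ih)) => t _; rewrite exprS.
by apply: (ucont_eq (ucontZ (n`!%:R^-1) cX)) => t _; rewrite mulrC.
Qed.

(** The term of rank n + 1 is the primitive of [k] times the term of rank n:
    the chain rule for powers, obtained from the product rule. *)
Lemma prim_exp_coeffS n t : 0 <= t <= T ->
  prim (fun s => prim_exp_coeff k n s * k s) t = prim_exp_coeff k n.+1 t.
Proof.
elim: n t => [|n ih] t ht; have /andP[t0 tT] := ht.
  rewrite /prim_exp_coeff expr1 divr1; apply: (eq_prim tT) => s _.
  by rewrite expr0 divr1 mul1r.
have ck := ucont_prim k_int.
have cE := ucont_prim_exp_coeff.
have IE i := intbleM T_ge0 (cE i) k_int.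
have h : prim k t * prim_exp_coeff k n.+1 t =
    prim (fun s => n.+2%:R * (prim_exp_coeff k n.+1 s * k s)) t.
  rewrite (prim_prod ck (cE n.+1) k_int (IE n))//.
  - rewrite prim0 mul0r add0r; apply: (eq_prim tT) => s _.
    rewrite /prim_exp_coeff factS natrM exprS -[n.+2%:R]natr1.
    by field; rewrite pnatr_eq0 -lt0n fact_gt0 addrC natr1 pnatr_eq0.
  - by move=> s _; rewrite prim0 add0r.
  - move=> s hs; rewrite ih// /prim_exp_coeff prim0.
    by rewrite expr0n mul0r add0r.
have n2 : n.+2%:R != 0 :> R by rewrite pnatr_eq0.
apply: (mulfI n2); rewrite -(primZ _ (IE n.+1) tT) -h /prim_exp_coeff.
rewrite [in RHS]factS natrM [in RHS]exprS; field.
by rewrite pnatr_eq0 -lt0n fact_gt0 -natrD pnatr_eq0.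
Qed.

Lemma iterated_gronwall (e : nat -> R -> R) (b c : R) :
  (forall n, ucont T (e n)) ->
  (forall t, 0 <= t <= T -> e 0%N t <= c) ->
  (forall n t, 0 <= t <= T -> e n.+1 t <= b + prim (fun s => e n s * k s) t) ->
  forall n t, 0 <= t <= T ->
  e n t <= b * (\sum_(i < n) prim_exp_coeff k i t) + c * prim_exp_coeff k n t.
Proof.
move=> ce e0 eS; elim=> [|n ih] t ht; have /andP[t0 tT] := ht.
  by rewrite big_ord0 mulr0 add0r /prim_exp_coeff expr0 divr1 mulr1 e0.
have cE := ucont_prim_exp_coeff; have IE i := intbleM T_ge0 (cE i) k_int.
have Ib := intbleZ b (intble_sum (index_enum 'I_n) (fun i : 'I_n => IE i)).
have Ic := intbleZ c (IE n).
apply: (le_trans (eS n t ht)).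
rewrite big_ord_recl {1}/prim_exp_coeff expr0 divr1 mulrDr mulr1 -addrA lerD2l.
apply: (@le_trans _ _ (prim (fun s =>
  b * (\sum_(i < n) prim_exp_coeff k i s * k s) + c * (prim_exp_coeff k n s * k s)) t)).
  apply: (prim_le (intbleM T_ge0 (ce n) k_int) (intbleD Ib Ic) tT) => s /andP[s0 st].
  have hs : 0 <= s <= T by rewrite s0 (le_trans st).
  rewrite -mulr_suml (mulrA b) (mulrA c) -mulrDl.
  by apply: ler_wpM2r; [exact: k_ge0|exact: ih].
rewrite (primD Ib Ic tT) (primZ _ (IE n) tT) prim_exp_coeffS// lerD2r.
rewrite (primZ _ (intble_sum _ (fun i : 'I_n => IE i)) tT).
rewrite (prim_sum _ (fun i : 'I_n => IE i) tT).
by under eq_bigr do rewrite prim_exp_coeffS//.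
Qed.

Lemma sum_exp_coeff_le_expR (x : R) n : 0 <= x ->
  \sum_(i < n) x ^+ i / i`!%:R <= expR x.
Proof.
move=> x0; have := @is_cvg_series_exp_coeff R x => cx.
rewrite (_ : \sum_(i < n) _ = series (exp_coeff x) n); last first.
  by rewrite /series /= big_mkord.
apply: (nondecreasing_cvgn_le _ cx).
by apply: nondecreasing_series => i _ _; exact: exp_coeff_ge0.
Qed.

Lemma exp_coeff_small (x c e : R) : 0 < e -> exists n, c * (x ^+ n / n`!%:R) <= e.
Proof.
move=> e0; have c1 : 0 < `|c| + 1 by rewrite ltr_wpDl.
have /cvgrPdist_lt /(_ _ (divr_gt0 e0 c1)) [n _ /(_ n (leqnn n))] := @cvg_exp_coeff R x.
rewrite /exp_coeff /= sub0r normrN ltr_pdivlMr// => h; exists n.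
apply: (le_trans (ler_norm _)); rewrite normrM mulrC.
by apply: ltW; apply: le_lt_trans h; rewrite ler_wpM2l// lerDl.
Qed.

Lemma iterated_gronwall_le (e : nat -> R -> R) (b c h : R) :
  0 <= b -> 0 <= c -> prim k T <= h ->
  (forall n, ucont T (e n)) ->
  (forall t, 0 <= t <= T -> e 0%N t <= c) ->
  (forall n t, 0 <= t <= T -> e n.+1 t <= b + prim (fun s => e n s * k s) t) ->
  forall n t, 0 <= t <= T -> e n t <= b * expR h + c * (h ^+ n / n`!%:R).
Proof.
move=> b0 c0 kh ce e0 eS n t ht; have /andP[t0 tT] := ht.
apply: (le_trans (iterated_gronwall ce e0 eS n ht)).
have p0 : 0 <= prim k t.
  by apply: prim_ge0 => s /andP[s0 st]; rewrite k_ge0// s0 (le_trans st).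
have ph : prim k t <= h.
  by apply: le_trans kh; exact: (prim_mono k_int k_ge0).
have Eh i : prim_exp_coeff k i t <= h ^+ i / i`!%:R.
  by rewrite ler_wpM2r ?invr_ge0// lerXn2r// nnegrE (le_trans p0).
apply: lerD; apply: ler_wpM2l => //.
apply: le_trans (sum_exp_coeff_le_expR n (le_trans p0 ph)).
by apply: ler_sum => i _; exact: Eh.
Qed.

(** Gronwall's inequality is the iterated one for a constant sequence, whose
    remainder tends to 0. *)
Lemma gronwall (w : R -> R) (b h : R) : 0 <= b -> prim k T <= h -> ucont T w ->
  (forall t, 0 <= t <= T -> w t <= b + prim (fun s => w s * k s) t) ->
  forall t, 0 <= t <= T -> w t <= b * expR h.
Proof.
move=> b0 kh cw hw t ht; apply/ler_addgt0Pr => e e_gt0.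
have [c c0 wc] := ucont_bounded T_ge0 cw.
have [n hn] := exp_coeff_small h c e_gt0.
have wc' s : 0 <= s <= T -> w s <= c by move=> /wc; exact: le_trans (ler_norm _).
have := iterated_gronwall_le b0 c0 kh (fun=> cw) wc' (fun=> hw) n ht.
by move=> /le_trans; apply; rewrite lerD2l.
Qed.

End Gronwall.

(** * Compact sets of controls are bounded *)

Section compact_controls.
Context {R : realType} {m : nat} {T : R}.
Hypothesis T_ge0 : 0 <= T.
Implicit Types (u v : L2 m T) (t : R).

Lemma intble_frob_sqr u : intble T (fun t => frob (u t) ^+ 2).
Proof. exact: L2_integrable. Qed.

Lemma frob_sqrB_le (q r : nat) (A B : 'M[R]_(q, r)) :
  frob (A - B) ^+ 2 <= 2 * frob A ^+ 2 + 2 * frob B ^+ 2.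
Proof.
rewrite !frob_sqr !mulr_sumr -big_split ler_sum// => i _.
rewrite !mulr_sumr -big_split ler_sum// => j _; rewrite !mxE /=.
set a := A i j; set b := B i j; rewrite -subr_ge0.
have -> : 2 * a ^+ 2 + 2 * b ^+ 2 - (a - b) ^+ 2 = (a + b) ^+ 2 by ring.
exact: sqr_ge0.
Qed.

Lemma intble_frob_sqrB u v : intble T (fun t => frob (u t - v t) ^+ 2).
Proof.
apply: (@intble_le _ T _ (fun t => 2 * frob (u t) ^+ 2 + 2 * frob (v t) ^+ 2)).
- apply: (eq_measurable_fun
      (fun t : R => \sum_i \sum_j (u t i 0 - v t i 0) ^+ 2)) => [t _|].
    rewrite frob_sqr; apply: eq_bigr => i _; apply: eq_bigr => j _.
    by rewrite ord1 !mxE.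
  apply: measurable_sum => i; apply: measurable_sum => j.
  by apply/measurable_funX/measurable_funB; exact: L2_measurable.
- by apply: intbleD; apply: intbleZ; exact: intble_frob_sqr.
- by move=> t _; rewrite ger0_norm ?sqr_ge0// frob_sqrB_le.
Qed.

(** The balls of integer radius around a point of [K] cover [K]. *)
Lemma L2_compact_bounded (K : set (L2 m T)) : compact K ->
  exists B : R, forall u, K u -> prim (fun t => frob (u t) ^+ 2) T <= B.
Proof.
have [->|/set0P[v Kv] cK] := eqVneq K set0; first by exists 0.
have /compact_near_coveringP cover := cK.
have [|n _ /(_ n (leqnn n)) Kn] := cover nat \oo (fun n u => L2_dist v u < n%:R) _.
  move=> u Ku; pose N := (Num.truncn (L2_dist v u)).+1.
  exists (L2_ball u 1, [set n | (N < n)%N]) => /=.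
    split; first by exists 1 => //=.
    by exists N.+1.
  move=> [w n] /= [uw Nn].
  have h := L2_ball_triangle (_ : L2_ball v N%:R u) uw.
  apply: lt_le_trans (h _) _; first exact: truncnS_gt.
  by rewrite natr1 ler_nat.
exists (2 * n%:R ^+ 2 + 2 * prim (fun t => frob (v t) ^+ 2) T) => u Ku.
have Id := intble_frob_sqrB v u; have Iv := intble_frob_sqr v.
apply: (@le_trans _ _ (prim (fun t =>
    2 * frob (v t - u t) ^+ 2 + 2 * frob (v t) ^+ 2) T)).
  apply: (prim_le (intble_frob_sqr u) (intbleD (intbleZ 2 Id) (intbleZ 2 Iv))) => //.
  move=> t _; rewrite addrC; apply: le_trans (frob_sqrB_le _ _).
  by rewrite opprB addrC subrK.
rewrite (primD (intbleZ 2 Id) (intbleZ 2 Iv))// !(primZ _ Id, primZ _ Iv)//.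
rewrite lerD2r ler_wpM2l//.
have p0 : 0 <= prim (fun t => frob (v t - u t) ^+ 2) T.
  by apply: prim_ge0 => t _; exact: sqr_ge0.
rewrite -(sqr_sqrtr p0) lerXn2r ?nnegrE ?sqrtr_ge0//.
exact: ltW (Kn u Ku).
Qed.

(** An L^1 bound on the driving signal from an L^2 bound on the control. *)
Lemma drive_sum_bounded u (B : R) : prim (fun t => frob (u t) ^+ 2) T <= B ->
  prim (fun t => \sum_j `|drive u j t|) T <= m.+1%:R * (T + B).
Proof.
move=> uB; have I1 := intbleD (intble_cst T 1) (intble_frob_sqr u).
apply: (@le_trans _ _ (prim (fun t => m.+1%:R * (1 + frob (u t) ^+ 2)) T)).
  apply: (prim_le (intble_drive_sum u) (intbleZ _ I1)) => // t _.
  rewrite mulr_natl -[X in _ *+ X](card_ord m.+1) -sumr_const ler_sum// => j _.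
  move: j; apply: drive_case => [|i]; first by rewrite drive0 normr1 lerDl sqr_ge0.
  rewrite driveS; apply: (@le_trans _ _ (1 + u t i 0 ^+ 2)).
    by rewrite -[u t i 0 ^+ 2]real_normK ?num_real//; nra.
  by rewrite lerD2l entry_sqr_le_frob.
rewrite (primZ _ I1)// ler_wpM2l// (primD (intble_cst T 1) (intble_frob_sqr u))//.
by rewrite prim_cst// mul1r lerD2l.
Qed.

End compact_controls.

(** * Lipschitz maps in the l^1 distance *)

Section Lipschitz.
Context {R : realType} {d : nat}.
Implicit Types (x y : 'cV[R]_d).

Lemma locally_lipschitz_box (q r : nat) (g : 'cV[R]_d -> 'M[R]_(q, r)) (M : R) :
  locally_lipschitz g -> 0 < M -> exists2 L, 0 <= L & forall i j x y,
    box M x -> box M y -> `|g x i j - g y i j| <= L * dist1 x y.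
Proof.
move=> gL M0; have r0 : 0 < d%:R * M + 1 by rewrite ltr_wpDl// mulr_ge0// ltW.
have [L L0 HL] := gL _ r0; exists L; first exact: ltW.
have fb x : box M x -> frob x <= d%:R * M + 1.
  move=> xM; rewrite (le_trans (frob_cV_le x))//.
  apply: (@le_trans _ _ (d%:R * M)); last by rewrite lerDl.
  rewrite mulr_natl -[X in _ *+ X](card_ord d) -sumr_const.
  by apply: ler_sum => i _; exact: xM.
move=> i j x y xM yM.
have -> : g x i j - g y i j = (g x - g y) i j by rewrite !mxE.
rewrite (le_trans (entry_le_frob _ i j))// (le_trans (HL _ _ (fb _ xM) (fb _ yM)))//.
rewrite ler_wpM2l ?(ltW L0)// (le_trans (frob_cV_le _))//.
by apply: ler_sum => k _; rewrite !mxE.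
Qed.

Lemma ucont_sum_dist (T : R) (I : finType) (a : I -> R -> R) : (forall i, ucont T (a i)) ->
  forall e : R, 0 < e -> exists2 dl : R, 0 < dl & forall s t : R,
    0 <= s <= T -> 0 <= t <= T -> `|s - t| < dl -> \sum_i `|a i s - a i t| < e.
Proof.
move=> ca; elim: (index_enum I) => [|i r ih] e e0.
  by exists 1 => // s t _ _ _; rewrite big_nil.
have e2 : 0 < e / 2 by rewrite divr_gt0.
have [d1 d10 H1] := ca i _ e2; have [d2 d20 H2] := ih _ e2.
exists (Num.min d1 d2); first by rewrite lt_min d10.
move=> s t hs ht; rewrite lt_min => /andP[/(H1 _ _ hs ht) h1 /(H2 _ _ hs ht) h2].
by rewrite big_cons [e]splitr ltrD.
Qed.

Lemma ucont_lipschitz (T L : R) (F : R -> R) (x : R -> 'cV[R]_d) : 0 <= L ->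
  (forall i, ucont T (fun t => x t i 0)) ->
  (forall s t, 0 <= s <= T -> 0 <= t <= T -> `|F s - F t| <= L * dist1 (x s) (x t)) ->
  ucont T F.
Proof.
move=> L0 cx FL e e0; have L1 : 0 < L + 1 by rewrite ltr_wpDl.
have [dl dl0 H] := ucont_sum_dist cx (divr_gt0 e0 L1); exists dl => // s t hs ht st.
apply: (le_lt_trans (FL s t hs ht)).
have := H s t hs ht st; rewrite ltr_pdivlMr// mulrC; apply: le_lt_trans.
by rewrite ler_wpM2r ?dist1_ge0// lerDl.
Qed.

Lemma ucont_dist1 (T : R) (x y : R -> 'cV[R]_d) :
  (forall i, ucont T (fun t => x t i 0)) -> (forall i, ucont T (fun t => y t i 0)) ->
  ucont T (fun t => dist1 (x t) (y t)).
Proof.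
move=> cx cy; apply: ucont_sum => i; apply: ucont_norm.
by apply: (ucont_eq (ucontD (cx i) (ucontZ (- 1) (cy i)))) => t _; rewrite mulN1r.
Qed.

Lemma ucont_box (T : R) (x : R -> 'cV[R]_d) : 0 <= T ->
  (forall i, ucont T (fun t => x t i 0)) ->
  exists2 M, 0 < M & forall t, 0 <= t <= T -> box M (x t).
Proof.
move=> T0 cx.
have c : ucont T (fun t => \sum_i `|x t i 0|).
  by apply: ucont_sum => i; exact: ucont_norm (cx i).
have [M M0 HM] := ucont_bounded T0 c; exists (M + 1); first by rewrite ltr_wpDl.
move=> t ht i; have := HM t ht; rewrite ger0_norm ?sumr_ge0// => h.
rewrite (@le_trans _ _ M)// ?lerDl// (le_trans _ h)//.
by rewrite (bigD1 i)//= lerDl sumr_ge0.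
Qed.

End Lipschitz.

(** * A priori bound for the controlled equation *)

Section controlled_equation.
Context {R : realType} {T : R} {d m : nat}.
Hypothesis T_ge0 : 0 <= T.
Variables (x0 : 'cV[R]_d) (f0 : 'cV[R]_d -> 'cV[R]_d) (f : 'cV[R]_d -> 'M[R]_(d, m)).
Hypothesis f0_lip : locally_lipschitz f0.
Hypothesis f_lip : locally_lipschitz f.

(** The drift and the control vector fields as the columns of one matrix, so that
    the right-hand side of the equation is [field x] applied to (1, u). *)
Definition field (x : 'cV[R]_d) : 'M[R]_(d, m.+1) := row_mx (f0 x) (f x).

Lemma field_drive (u : L2 m T) x s i :
  (f0 x + f x *m u s) i 0 = \sum_j field x i j * drive u j s.
Proof.
have -> : f0 x + f x *m u s =
    row_mx (f0 x) (f x) *m col_mx (1%:M : 'M[R]_1) (u s).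
  by rewrite mul_row_col mulmx1.
by rewrite mxE.
Qed.

Lemma field_lipschitz M : 0 < M -> exists2 L, 0 <= L & forall i j x y,
    box M x -> box M y -> `|field x i j - field y i j| <= L * dist1 x y.
Proof.
move=> M0; have [L0 L00 H0] := locally_lipschitz_box f0_lip M0.
have [L1 L10 H1] := locally_lipschitz_box f_lip M0.
exists (L0 + L1); first exact: addr_ge0.
move=> i j x y xM yM; rewrite /field mulrDl.
case: (split_ordP (j : 'I_(1 + m))) => k ->.
  have := H0 i k _ _ xM yM.
  rewrite -(row_mxEl (f0 x) (f x)) -(row_mxEl (f0 y) (f y)) => /le_trans; apply.
  by rewrite lerDl mulr_ge0// dist1_ge0.
have := H1 i k _ _ xM yM.
rewrite -(row_mxEr (f0 x) (f x)) -(row_mxEr (f0 y) (f y)) => /le_trans; apply.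
by rewrite lerDr mulr_ge0// dist1_ge0.
Qed.

Variables (u : L2 m T) (x : R -> 'cV[R]_d).
Hypothesis x_sol : is_solution T x0 f0 f u x.

Lemma solution_ucont i : ucont T (fun t => x t i 0).
Proof.
move=> e e0; have [ac _] := x_sol; have [dl dl0 H] := ac e e0; exists dl => //.
have main s t : 0 <= s -> s <= t -> t <= T -> t - s < dl -> `|x t i 0 - x s i 0| < e.
  move=> s0 st tT std.
  have := H 1%N (fun=> s) (fun=> t); rewrite !big_ord1 => h.
  have -> : x t i 0 - x s i 0 = (x t - x s) i 0 by rewrite !mxE.
  apply: le_lt_trans (entry_le_frob _ i 0) _; apply: h => //.
  by move=> j k; rewrite !ord1 eqxx.
move=> s t /andP[s0 sT] /andP[t0 tT] std.
have [st|/ltW ts] := leP s t.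
  rewrite distrC main//; apply: le_lt_trans std.
  by rewrite distrC ler_norm.
by rewrite main//; apply: le_lt_trans std; rewrite ler_norm.
Qed.

Lemma field_ucont i j : ucont T (fun t => field (x t) i j).
Proof.
have [M M0 xM] := ucont_box T_ge0 solution_ucont.
have [L L0 HL] := field_lipschitz M0.
apply: (ucont_lipschitz L0 solution_ucont) => s t hs ht.
by apply: HL; exact: xM.
Qed.

Lemma intble_field_drive i j : intble T (fun s => field (x s) i j * drive u j s).
Proof. by apply: intbleM => //; [exact: field_ucont|exact: intble_drive]. Qed.

Lemma solutionE i t : 0 <= t <= T ->
  x t i 0 = x0 i 0 + prim (fun s => \sum_j field (x s) i j * drive u j s) t.
Proof.
move=> ht; have [_ ->//] := x_sol; rewrite !mxE; congr (_ + _).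
by have /andP[_ tT] := ht; apply: (eq_prim tT) => s _; rewrite field_drive.
Qed.

Lemma solution0 i : x 0 i 0 = x0 i 0.
Proof. by rewrite solutionE ?lexx// prim0 addr0. Qed.

(** Here 2 y_i f_ij v_j <= f_ij^2 + y_i^2 v_j^2 lets the Frobenius norm in the
    growth condition absorb the control term. *)
Lemma growth_bound (C0 : R) y (v : 'cV[R]_m) :
  2 * inner y (f0 y) + frob (f y) ^+ 2 <= C0 * (1 + frob y ^+ 2) ->
  \sum_i 2 * (y i 0 * (f0 y + f y *m v) i 0) <=
  (1 + \sum_i y i 0 ^+ 2) * (Num.max C0 0 + frob v ^+ 2).
Proof.
move=> h; have ny q (z : 'cV[R]_q) : frob z ^+ 2 = \sum_i z i 0 ^+ 2.
  by rewrite frob_sqr; apply: eq_bigr => i _; rewrite big_ord1.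
set S := \sum_i y i 0 ^+ 2; have S0 : 0 <= S by apply: sumr_ge0 => i _; exact: sqr_ge0.
have -> : \sum_i 2 * (y i 0 * (f0 y + f y *m v) i 0) =
    2 * inner y (f0 y) + \sum_i \sum_j 2 * (y i 0 * f y i j * v j 0).
  rewrite /inner mulr_sumr -big_split /=; apply: eq_bigr => i _.
  rewrite !mxE mulrDr mulrDr; congr (_ + _).
  by rewrite !mulr_sumr; apply: eq_bigr => j _; ring.
have cross : \sum_i \sum_j 2 * (y i 0 * f y i j * v j 0) <=
    frob (f y) ^+ 2 + S * frob v ^+ 2.
  rewrite ny frob_sqr /S mulr_suml -big_split /= ler_sum// => i _.
  rewrite mulr_sumr -big_split /= ler_sum// => j _.
  rewrite -subr_ge0.
  have -> : f y i j ^+ 2 + y i 0 ^+ 2 * v j 0 ^+ 2 - 2 * (y i 0 * f y i j * v j 0) =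
    (f y i j - y i 0 * v j 0) ^+ 2 by ring.
  exact: sqr_ge0.
have C1 : C0 * (1 + S) <= Num.max C0 0 * (1 + S).
  by rewrite ler_wpM2r ?le_max ?lexx// addr_ge0.
have v0 := sqr_ge0 (frob v).
move: h; rewrite ny -/S => h.
rewrite mulrDr [(1 + S) * Num.max _ _]mulrC mulrDl mul1r.
move: cross C1 h v0; set a := \sum_i \sum_j _; set b := frob v ^+ 2; set c := frob _ ^+ 2.
lra.
Qed.

Lemma solution_bounded (C0 B : R) :
  (forall y, 2 * inner y (f0 y) + frob (f y) ^+ 2 <= C0 * (1 + frob y ^+ 2)) ->
  prim (fun t => frob (u t) ^+ 2) T <= B ->
  forall t, 0 <= t <= T ->
  box (1 + (1 + \sum_i x0 i 0 ^+ 2) * expR (Num.max C0 0 * T + B)) (x t).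
Proof.
move=> growth uB.
pose phi i s := \sum_j field (x s) i j * drive u j s.
have Iphi i : intble T (phi i) by apply: intble_sum => j; exact: intble_field_drive.
have Iu := intble_frob_sqr u.
(* Gronwall's inequality for w = 1 + |x|^2 with kernel k = max(C0, 0) + |u|^2. *)
pose w t := 1 + \sum_i x t i 0 ^+ 2.
pose k t := Num.max C0 0 + frob (u t) ^+ 2.
have Ik : intble T k by apply: intbleD => //; exact: intble_cst.
have k0 t : 0 <= t <= T -> 0 <= k t.
  by move=> _; rewrite addr_ge0 ?sqr_ge0// le_max lexx orbT.
have cw : ucont T w.
  apply: ucontD; first exact: ucont_cst.
  by apply: ucont_sum => i; apply: ucontM => //; exact: solution_ucont.
have Ixphi i := intbleM T_ge0 (solution_ucont i) (Iphi i).
have Ixx i : intble T (fun s => 2 * (x s i 0 * phi i s)) by exact: intbleZ.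
have wE t : 0 <= t <= T ->
    w t = 1 + \sum_i x0 i 0 ^+ 2 + prim (fun s => \sum_i 2 * (x s i 0 * phi i s)) t.
  move=> ht; have /andP[t0 tT] := ht.
  rewrite (prim_sum _ Ixx tT) -addrA -big_split /=; congr (1 + _).
  apply: eq_bigr => i _; rewrite [LHS]expr2.
  rewrite (prim_prod (solution_ucont i) (solution_ucont i) (Iphi i) (Iphi i))//.
  - rewrite solution0 expr2; congr (_ + _).
    by apply: (eq_prim tT) => s _; ring.
  - by move=> s hs; rewrite solution0 solutionE.
  - by move=> s hs; rewrite solution0 solutionE.
have b0 : 0 <= 1 + \sum_i x0 i 0 ^+ 2.
  by rewrite addr_ge0// sumr_ge0// => i _; exact: sqr_ge0.
have kT : prim k T <= Num.max C0 0 * T + B.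
  by rewrite (primD (intble_cst T _) Iu)// prim_cst// lerD2l.
have wB := gronwall T_ge0 Ik k0 b0 kT cw.
move=> t ht i; have {}wB : w t <= (1 + \sum_i x0 i 0 ^+ 2) * expR (Num.max C0 0 * T + B).
  apply: wB => // s hs; rewrite wE// lerD2l; have /andP[s0 sT] := hs.
  apply: (prim_le (intble_sum _ Ixx) (intbleM T_ge0 cw Ik) sT) => r _.
  apply: le_trans (growth_bound (u r) (growth (x r))).
  by apply: ler_sum => j _; rewrite field_drive.
have xi : x t i 0 ^+ 2 <= w t.
  rewrite /w (bigD1 i)//= addrCA lerDl addr_ge0// sumr_ge0// => j _; exact: sqr_ge0.
(* Avoids the square root in the bound. *)
have : `|x t i 0| <= 1 + x t i 0 ^+ 2.
  by rewrite -[x t i 0 ^+ 2]real_normK ?num_real//; nra.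
move/le_trans; apply; rewrite lerD2l; exact: le_trans xi wB.
Qed.

End controlled_equation.

(** * Picard iterates *)

Section Picard.
Context {R : realType} {T : R} {d m : nat}.
Hypothesis T_ge0 : 0 <= T.
Variables (K : set (L2 m T)) (H : R).
Hypothesis KH : forall u, K u -> prim (fun t => \sum_j `|drive u j t|) T <= H.
Implicit Types (u : L2 m T) (s t : R).

(** A function that is Lipschitz on a box is uniformly close there to a globally
    Lipschitz function, with the same constant, into which uniform limits of
    signature functionals can be substituted. *)
Lemma lipschitz_substitute (g : 'cV[R]_d -> R) (M L eta : R) :
  0 < M -> 0 <= L -> 0 < eta ->
  (forall x y, box M x -> box M y -> `|g x - g y| <= L * dist1 x y) ->
  exists G : 'cV[R]_d -> R,
    [/\ forall x, box M x -> `|g x - G x| <= eta,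
        forall x y, `|G x - G y| <= L * dist1 x y &
        forall a : L2 m T -> R -> 'cV[R]_d,
          (forall i, sigapprox K (fun u t => a u t i 0)) ->
          sigapprox K (fun u t => G (a u t))].
Proof.
move=> M0 L0 eta0 gL; have [z0 [Z HZ]] := mcshane_approx M0 L0 eta0 gL.
exists (mcshane g L z0 Z); split => //.
  by move=> x y; exact: mcshane_lipschitz.
by move=> a; exact: (sigapprox_mcshane T_ge0 KH).
Qed.

Variable x0 : 'cV[R]_d.

(** The Picard iterates, started at the constant path [x0], of the equation with
    vector fields [G]. *)
Fixpoint picard (G : 'I_d -> 'I_m.+1 -> 'cV[R]_d -> R) (n : nat) u t : 'cV[R]_d :=
  if n is n'.+1 then
    \col_i (x0 i 0 + \sum_j prim (fun s => G i j (picard G n' u s) * drive u j s) t)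
  else x0.

Lemma sigapprox_picard G :
  (forall i j (a : L2 m T -> R -> 'cV[R]_d),
     (forall i, sigapprox K (fun u t => a u t i 0)) ->
     sigapprox K (fun u t => G i j (a u t))) ->
  forall n i, sigapprox K (fun u t => picard G n u t i 0).
Proof.
move=> GK; elim=> [|n ih] i /=; first exact: sigapprox_cst.
have h : sigapprox K (fun u t =>
    x0 i 0 + \sum_j prim (fun s => G i j (picard G n u s) * drive u j s) t).
  apply: sigapproxD; first exact: sigapprox_cst.
  by apply: sigapprox_sum => j; apply: (sigapprox_prim T_ge0 KH); exact: GK.
by apply: (sigapprox_eq h) => u t _ _; rewrite mxE.
Qed.

Variables (f0 : 'cV[R]_d -> 'cV[R]_d) (f : 'cV[R]_d -> 'M[R]_(d, m)).
Hypothesis f0_lip : locally_lipschitz f0.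
Hypothesis f_lip : locally_lipschitz f.
Variable x : L2 m T -> R -> 'cV[R]_d.
Hypothesis x_sol : forall u, is_solution T x0 f0 f u (x u).
Variable M : R.
Hypothesis M_gt0 : 0 < M.
Hypothesis xM : forall u t, K u -> 0 <= t <= T -> box M (x u t).

(** The hypothesis of the iterated Gronwall inequality: comparison of the
    solution with the Picard iterates when [G] is [eta]-close to the vector
    fields on the box that contains the solution. *)
Lemma picard_step G n u (L eta : R) : K u -> 0 <= L -> 0 <= eta ->
  (forall i j y, box M y -> `|field f0 f y i j - G i j y| <= eta) ->
  (forall i j y z, `|G i j y - G i j z| <= L * dist1 y z) ->
  (forall i, ucont T (fun t => picard G n u t i 0)) ->
  forall t, 0 <= t <= T ->
  dist1 (x u t) (picard G n.+1 u t) <= d%:R * (eta * H) +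
    prim (fun s => dist1 (x u s) (picard G n u s) *
                   (d%:R * L * \sum_j `|drive u j s|)) t.
Proof.
move=> Ku L0 eta0 GV GL cp t ht; have /andP[t0 tT] := ht.
set e := fun s => dist1 (x u s) (picard G n u s).
have cx i : ucont T (fun t => x u t i 0) by exact: solution_ucont (x_sol u) i.
have ce : ucont T e by exact: ucont_dist1.
have Id j := intble_drive u j.
have Is := intble_drive_sum u.
have cG i j : ucont T (fun s => G i j (picard G n u s)).
  by apply: (ucont_lipschitz L0 cp) => s r _ _; exact: GL.
have IG i j := intbleM T_ge0 (cG i j) (Id j).
have IV i j := intble_field_drive T_ge0 f0_lip f_lip (x_sol u) i j.
have IGs i : intble T (fun s => \sum_j G i j (picard G n u s) * drive u j s).
  exact: intble_sum.
have IVs i : intble T (fun s => \sum_j field f0 f (x u s) i j * drive u j s).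
  exact: intble_sum.
have Ieh := intbleM T_ge0 ce (intbleZ (d%:R * L) Is).
have Ieh' := intbleM T_ge0 ce (intbleZ L Is).
have I1 := intbleZ eta Is.
have coord i : `|x u t i 0 - picard G n.+1 u t i 0| <=
    eta * H + prim (fun s => e s * (L * \sum_j `|drive u j s|)) t.
  rewrite (solutionE (x_sol u))// [picard _ _ _ _ _ _]mxE.
  rewrite -(prim_sum _ (IG i) tT) opprD addrACA subrr add0r -(primB (IVs i) (IGs i) tT).
  have Idiff := intbleD (IVs i) (intbleZ (- 1) (IGs i)).
  rewrite (eq_prim (g := fun s => \sum_j field f0 f (x u s) i j * drive u j s +
    - 1 * \sum_j G i j (picard G n u s) * drive u j s) tT); last first.
    by move=> s _; rewrite mulN1r.
  apply: (le_trans (prim_norm Idiff tT)).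
  apply: (@le_trans _ _ (prim (fun s => eta * (\sum_j `|drive u j s|) +
                               e s * (L * \sum_j `|drive u j s|)) t)).
    apply: (prim_le (intble_norm Idiff) (intbleD I1 Ieh') tT) => s /andP[s0 st].
    have hs : 0 <= s <= T by rewrite s0 (le_trans st).
    rewrite mulN1r -sumrB mulrA -mulrDl mulr_sumr (le_trans (ler_norm_sum _ _ _))//.
    apply: ler_sum => j _; rewrite -mulrBl normrM ler_wpM2r//.
    rewrite -(subrKA (G i j (x u s))) (le_trans (ler_normD _ _))// lerD//.
      by apply: GV; exact: xM.
    by rewrite mulrC GL.
  rewrite (primD I1 Ieh' tT) lerD2r (primZ _ Is tT) ler_wpM2l//.
  by apply: le_trans (KH Ku); apply: (prim_mono Is) => // r _; exact: sumr_ge0.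
have -> : prim (fun s => e s * (d%:R * L * \sum_j `|drive u j s|)) t =
    d%:R * prim (fun s => e s * (L * \sum_j `|drive u j s|)) t.
  by rewrite -(primZ _ Ieh' tT); apply: (eq_prim tT) => s _; ring.
rewrite -mulrDr mulr_natl -[X in _ *+ X](card_ord d) -sumr_const.
by apply: ler_sum => i _; exact: coord.
Qed.

Lemma solution_approx (e : R) : 0 < e -> exists2 z : L2 m T -> R -> 'cV[R]_d,
  forall i, sigapprox K (fun u t => z u t i 0) &
  forall u t, K u -> 0 <= t <= T -> dist1 (x u t) (z u t) <= e.
Proof.
move=> e0; have [L L0 HL] := field_lipschitz f0_lip f_lip M_gt0.
(* The final error is at most A eta + c h^n / n!, where A depends only on L
   and H: eta is chosen first, then n. *)
pose h := d%:R * L * H; pose A := d%:R * `|H| * expR h.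
have A0 : 0 <= A by rewrite !mulr_ge0// expR_ge0.
have A1 : 0 < A + 1 by rewrite ltr_wpDl.
have eta0 : 0 < e / 2 / (A + 1) by rewrite !divr_gt0.
set eta := e / 2 / (A + 1) in eta0.
have Aeta : A * eta <= e / 2.
  by rewrite /eta mulrCA ger_pMr ?divr_gt0// ler_pdivrMr// mul1r lerDl.
have /choice[G' HG'] : forall ij : 'I_d * 'I_m.+1, exists G : 'cV[R]_d -> R,
    [/\ forall y, box M y -> `|field f0 f y ij.1 ij.2 - G y| <= eta,
        forall y z, `|G y - G z| <= L * dist1 y z &
        forall a : L2 m T -> R -> 'cV[R]_d,
          (forall i, sigapprox K (fun u t => a u t i 0)) ->
          sigapprox K (fun u t => G (a u t))].
  by move=> [i j]; apply: lipschitz_substitute => //; exact: HL.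
pose G i j := G' (i, j).
have GV i j y : box M y -> `|field f0 f y i j - G i j y| <= eta.
  by have [+ _ _] := HG' (i, j); apply.
have GL i j y z : `|G i j y - G i j z| <= L * dist1 y z.
  by have [_ + _] := HG' (i, j); apply.
have GK i j (a : L2 m T -> R -> 'cV[R]_d) :
    (forall i, sigapprox K (fun u t => a u t i 0)) ->
    sigapprox K (fun u t => G i j (a u t)).
  by have [_ _] := HG' (i, j); apply.
have pK := sigapprox_picard GK.
pose c := d%:R * M + \sum_i `|x0 i 0|.
have c0 : 0 <= c by rewrite addr_ge0 ?sumr_ge0// mulr_ge0// ltW.
have e2 : 0 < e / 2 by rewrite divr_gt0.
have [n hn] := exp_coeff_small h c e2.
exists (picard G n); first exact: pK.
move=> u t Ku ht.
have Is := intble_drive_sum u.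
have k0 s : 0 <= s <= T -> 0 <= d%:R * L * \sum_j `|drive u j s|.
  by move=> _; rewrite mulr_ge0 ?sumr_ge0// mulr_ge0.
have cp k i : ucont T (fun t => picard G k u t i 0) by have [+ _] := pK k i; apply.
have H0 : 0 <= H by apply: le_trans (KH Ku); apply: prim_ge0 => s _; exact: sumr_ge0.
have b0 : 0 <= d%:R * (eta * H) by rewrite mulr_ge0// mulr_ge0// ltW.
have kT : prim (fun s => d%:R * L * \sum_j `|drive u j s|) T <= h.
  by rewrite (primZ _ Is)// /h ler_wpM2l ?mulr_ge0//; exact: KH.
have := iterated_gronwall_le (e := fun k s => dist1 (x u s) (picard G k u s))
  T_ge0 (intbleZ _ Is) k0 b0 c0 kT.
move=> /(_ _ _ _ n t ht) main; apply: (le_trans (main _ _ _)).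
- move=> k; apply: ucont_dist1 => i; last exact: cp.
  exact: solution_ucont (x_sol u) i.
- move=> s hs /=; rewrite /c mulr_natl -[X in _ *+ X](card_ord d) -sumr_const -big_split.
  apply: ler_sum => i _ /=; rewrite (le_trans (ler_normB _ _))// lerD2r.
  exact: xM.
- move=> k s hs; apply: picard_step => //; exact: ltW.
- rewrite [e]splitr lerD//; apply: le_trans Aeta.
  by rewrite /A (ger0_norm H0) le_eqVlt; apply/orP; left; apply/eqP; ring.
Qed.

Lemma output_approx (p : nat) (c : 'cV[R]_d -> 'cV[R]_p) (i : 'I_p) (e : R) :
  locally_lipschitz c -> 0 < e -> exists2 b : L2 m T -> R -> R, sigfun b &
    forall u t, K u -> 0 <= t <= T -> `|c (x u t) i 0 - b u t| <= e.
Proof.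
move=> c_lip e0; have [L L0 HL] := locally_lipschitz_box c_lip M_gt0.
have e3 : 0 < e / 3 by rewrite divr_gt0.
have [G [Gc GL GK]] := lipschitz_substitute M_gt0 L0 e3 (HL i 0).
have L1 : 0 < L + 1 by rewrite ltr_wpDl.
have [z zK xz] := solution_approx (divr_gt0 e3 L1).
have [_ /(_ _ e3) [b sb hb]] := GK z zK.
exists b => // u t Ku ht.
have h1 := Gc _ (xM Ku ht).
have h2 : `|G (x u t) - G (z u t)| <= e / 3.
  apply: (le_trans (GL _ _)); apply: (@le_trans _ _ (L * (e / 3 / (L + 1)))).
    by rewrite ler_wpM2l// xz.
  by rewrite mulrCA ger_pMr// ler_pdivrMr// mul1r lerDl.
have h3 := hb u t Ku ht.
have -> : c (x u t) i 0 - b u t = (c (x u t) i 0 - G (x u t)) +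
  (G (x u t) - G (z u t)) + (G (z u t) - b u t) by ring.
rewrite (le_trans (ler_normD _ _))// (_ : e = e / 3 + e / 3 + e / 3); last by field.
by rewrite lerD// (le_trans (ler_normD _ _))// lerD.
Qed.

End Picard.

Theorem corollary3p12 (R : realType) (T : R) (T_gt0 : 0 < T) (d m p : nat)
    (x0 : 'cV[R]_d) (f0 : 'cV[R]_d -> 'cV[R]_d)
    (f : 'cV[R]_d -> 'M[R]_(d, m)) (c : 'cV[R]_d -> 'cV[R]_p)
    (f0_lip : locally_lipschitz f0) (f_lip : locally_lipschitz f)
    (c_lip : locally_lipschitz c)
    (growth : exists C0 : R, forall x : 'cV[R]_d,
       2 * inner x (f0 x) + frob (f x) ^+ 2 <= C0 * (1 + frob x ^+ 2))
    (x : L2 m T -> R -> 'cV[R]_d)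
    (x_sol : forall u : L2 m T, is_solution T x0 f0 f u (x u))
    (K : set (L2 m T)) (K_compact : compact K) (eps : R) (eps_gt0 : 0 < eps) :
  exists (N : nat) (C : 'M[R]_(p, \sum_(k < N.+1) m.+1 ^ k)),
    (ereal_sup [set ereal_sup
       [set (frob (c (x u t) - C *m signature (augmented_path u) N 0 t))%:E
         | u in K] | t in `[0%R, T]] < eps%:E)%E.
Proof.
have T_ge0 := ltW T_gt0.
have [B KB] := L2_compact_bounded K_compact.
have KH u (Ku : K u) := drive_sum_bounded T_ge0 (KB u Ku).
have [C0 growthC] := growth.
set M := 1 + (1 + \sum_i x0 i 0 ^+ 2) * expR (Num.max C0 0 * T + B).
have xM u t (Ku : K u) (ht : 0 <= t <= T) : box M (x u t).
  exact: (solution_bounded T_ge0 f0_lip f_lip (x_sol u) growthC (KB u Ku)).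
have M_gt0 : 0 < M.
  rewrite ltr_pwDl// mulr_ge0 ?expR_ge0// addr_ge0// sumr_ge0// => i _.
  exact: sqr_ge0.
have p0 : (0 : R) < p.+1%:R by rewrite ltr0n.
have e0 : 0 < eps / 2 / p.+1%:R by rewrite !divr_gt0.
have /choice[b Hb] : forall i : 'I_p, exists l : seq (R * seq 'I_m.+1),
    forall u t, K u -> 0 <= t <= T ->
      `|c (x u t) i 0 - sigcomb l u t| <= eps / 2 / p.+1%:R.
  move=> i; have [b [l bl] hb] :=
    output_approx T_ge0 KH f0_lip f_lip x_sol M_gt0 xM i c_lip e0.
  by exists l => u t Ku ht; rewrite -bl// hb.
have [N [C HC]] := sigcomb_signature T_ge0 b.
exists N, C; apply: (@le_lt_trans _ _ (eps / 2)%:E); last first.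
  by rewrite lte_fin ltr_pdivrMr// ltr_pMr// ltr1n.
apply: ge_ereal_sup => _ [t ht <-]; apply: ge_ereal_sup => _ [u Ku <-].
rewrite lee_fin; move: ht; rewrite /= in_itv/= => ht.
rewrite HC// (le_trans (frob_cV_le _))//.
apply: (@le_trans _ _ (\sum_(i < p) eps / 2 / p.+1%:R)).
  by apply: ler_sum => i _; rewrite !mxE Hb.
rewrite sumr_const card_ord -[leLHS]mulr_natr -[leLHS]mulrA ger_pMr ?divr_gt0//.
by rewrite mulrC ler_pdivrMr// mul1r ler_nat.
Qed.
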